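(* The assignment $A\mapsto AB^{p^m}$, $B\mapsto B B^{-(2-d)p^m}A^{p^m}$, where $d=0$ if $p\neq 3$ and $d=3^{m-1}\ell$ if $p=3$, extends to an automorphism, say $\Delta$, of $J$. Moreover, $$\mathrm{Inn}(J)\mathrm{Aut}_3(J)=\langle\Delta\rangle\mathrm{Inn}(J)\mathrm{Aut}_2(J),\qquad \mathrm{Aut}_3(J)=\langle\Delta,C\delta\rangle\mathrm{Aut}_2(J),$$ $$\mathrm{Aut}_3(J)/\mathrm{Aut}_2(J)\cong\mathbb Z/p^m\mathbb Z\times\mathbb Z/p^m\mathbb Z,\qquad \mathrm{Inn}(J)\mathrm{Aut}_3(J)/\mathrm{Inn}(J)\mathrm{Aut}_2(J)\cong\mathbb Z/p^m\mathbb Z,$$ $$|\mathrm{Aut}_3(J)|=p^{6m},\qquad |\mathrm{Inn}(J)\mathrm{Aut}_3(J)|=p^{8m}.$$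
   Context: $p$ is an odd prime, $m\geq 1$ an integer, and $\alpha>1$ an integer with $v_p(\alpha-1)=m$ ($v_p$ is the $p$-adic valuation); if $p=3$ and $m=1$, it is also assumed that $(\alpha-1)/3\equiv 1\bmod 3$. Write $\alpha=1+\ell p^m$ with $\ell\in\mathbb N$ (so $p\nmid\ell$). Conventions: $[x,y]=x^{-1}y^{-1}xy$, $x^y=y^{-1}xy$; functions are composed from left to right. $J$ is the group (a finite $p$-group of order $p^{7m}$ and nilpotency class 5) $$J=\langle A,B\,|\,A^{[A,B]}=A^\alpha,\ B^{[B,A]}=B^\alpha,\ A^{p^{3m}}=B^{p^{3m}}=1\rangle,$$ and $C=[A,B]$. For a group $T$, $1=Z_0(T)\subseteq Z_1(T)=Z(T)\subseteq Z_2(T)\subseteq\cdots$ is the upper central series, $\mathrm{Aut}_i(T)$ is the kernel of the canonical map $\mathrm{Aut}(T)\to\mathrm{Aut}(T/Z_i(T))$, $\mathrm{Inn}(T)$ is the group of inner automorphisms, and for $t\in T$, $t\delta\in\mathrm{Inn}(T)$ denotes conjugation by $t$, i.e. $x\mapsto x^t=t^{-1}xt$. *)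

(* Defs.v *)
From HB Require Import structures.
From mathcomp Require Import all_boot all_order all_algebra all_fingroup.
From mathcomp Require Import all_solvable.

Set Implicit Arguments.
Unset Strict Implicit.
Unset Printing Implicit Defensive.

Local Open Scope group_scope.

Definition expgz (gT : groupType) (x : gT) (n : int) : gT :=
  match n with Posz k => x ^+ k | Negz k => x ^- k.+1 end.

Definition J_relations (p m alpha : nat) (gT : groupType) (a b : gT) : Prop :=
  [/\ a ^ [~ a, b] = a ^+ alpha,
      b ^ [~ b, a] = b ^+ alpha,
      a ^+ (p ^ (3 * m)) = 1 &
      b ^+ (p ^ (3 * m)) = 1].

(* J is the group defined by the presentation
     < A, B | A^[A,B] = A^alpha, B^[B,A] = B^alpha, A^(p^3m) = B^(p^3m) = 1 >,
   with A and B the images of the free generators.  The library predicate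
   "J \isog Grp (...)" does not name the generators and only tests finite
   targets; here the universal property ranges over all groups.  The equation
   f (x * y) = f x * f y is restricted to J because f is total on gT. *)
Definition presents_J (p m alpha : nat) (gT : finGroupType) (J : {group gT})
    (A B : gT) : Prop :=
  [/\ <<[set A; B]>> = J,
      J_relations p m alpha A B &
      forall (rT : groupType) (a b : rT), J_relations p m alpha a b ->
        exists f : gT -> rT,
          [/\ {in J &, {morph f : x y / x * y}}, f A = a & f B = b]].

(* The kernel of Aut(T) -> Aut(T / Z_i(T)): the automorphisms of T that
   induce the identity on T / Z_i(T). *)
Definition Autn (i : nat) (gT : finGroupType) (T : {set gT}) :
    {set {perm gT}} :=
  [set s in Aut T |
    [forall x in T, coset 'Z_i(T) (s x) == coset 'Z_i(T) x]].

Definition Inn (gT : finGroupType) (T : {group gT}) : {set {perm gT}} :=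
  conj_aut T @* T.

Canonical Inn_group (gT : finGroupType) (T : {group gT}) :=
  Eval hnf in [group of Inn T].

Section AutnTheory.

Variables (gT : finGroupType) (T : {group gT}).

Lemma AutnP i s :
  reflect (s \in Aut T /\
           {in T, forall x, coset 'Z_i(T) (s x) = coset 'Z_i(T) x})
          (s \in Autn i T).
Proof.
apply: (iffP setIdP) => [[sA /forall_inP sZ] | [sA sZ]].
  by split=> // x Tx; apply/eqP/sZ.
by split=> //; apply/forall_inP=> x Tx; apply/eqP/sZ.
Qed.

Lemma Autn_group_set i : group_set (Autn i T).
Proof.
apply/group_setP; split=> [|s t].
  by apply/AutnP; split=> [|x _]; rewrite ?group1 ?perm1.
case/AutnP=> sA sZ /AutnP[tA tZ]; apply/AutnP; split=> [|x Tx].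
  exact: groupM.
by rewrite permM tZ ?Aut_closed // sZ.
Qed.

Canonical Autn_group i := Group (Autn_group_set i).

Lemma Autn_sub i : Autn i T \subset Aut T.
Proof. by apply/subsetP=> s /AutnP[]. Qed.

Lemma Autn_normal i : Autn i T <| Aut T.
Proof.
rewrite /normal Autn_sub; apply/subsetP=> t tA.
have tVA : t^-1 \in Aut T by rewrite groupV.
rewrite inE; apply/subsetP=> _ /imsetP[s /AutnP[sA sZ] ->].
apply/AutnP; split=> [|x Tx]; first by rewrite groupJ.
have Ty : t^-1 x \in T by apply: Aut_closed.
have nZ := subsetP (ucn_norm i T).
rewrite /conjg !permM.
have /rcoset_kercosetP : coset 'Z_i(T) (s (t^-1 x)) = coset 'Z_i(T) (t^-1 x).
  exact: sZ.
case/(_ (nZ _ (Aut_closed sA Ty)) (nZ _ Ty))/rcosetP=> z Zz ->.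
have Tz := subsetP (ucn_sub i T) z Zz.
rewrite (morphicP (Aut_morphic tA)) // permKV.
apply/rcoset_kercosetP; rewrite ?nZ ?groupM ?Aut_closed //.
rewrite mem_rcoset mulgK.
have /charP[_ chZ] := ucn_char i T.
have:= chZ (autm_morphism tA) (injm_autm tA) (im_autm tA) => <-.
by rewrite -[t z]/(autm tA z) mem_morphim.
Qed.

Lemma Inn_normal : Inn T <| Aut T.
Proof.
rewrite /normal Aut_conj_aut; apply/subsetP=> t tA.
rewrite inE; apply/subsetP=> _ /imsetP[_ /morphimP[x nTx Tx ->] ->].
have Ttx : t x \in T by apply: Aut_closed.
suff -> : conj_aut T x ^ t = conj_aut T (t x).
  by rewrite mem_morphim // (subsetP (normG T)).
have cA y : y \in T -> conj_aut T y \in Aut T by move=> Ty; apply: Aut_aut.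
apply: (@eq_Aut _ T); rewrite ?groupJ ?cA // => y Ty.
have tVA : t^-1 \in Aut T by rewrite groupV.
have Tw : t^-1 y \in T by apply: Aut_closed.
rewrite /conjg !permM !conj_autE //.
have tJ : {in T &, forall u v, t (u ^ v) = t u ^ t v}.
  exact: (morphJ (autm_morphism tA)).
by rewrite tJ // permKV.
Qed.

Lemma Inn_mul_Autn_group_set i : group_set (Inn T * Autn i T).
Proof.
have /andP[_ nI] := Inn_normal.
rewrite -norm_joinEr ?groupP //.
exact: subset_trans (Autn_sub i) nI.
Qed.

Lemma Inn_mul_Autn_normal i : Inn T * Autn i T <| Aut T.
Proof.
have /andP[_ nI] := Inn_normal.
rewrite -norm_joinEr ?normalY ?Inn_normal ?Autn_normal //.
exact: subset_trans (Autn_sub i) nI.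
Qed.

End AutnTheory.

(* Main.v *)
(** Write q = p^m, alpha = 1 + l q.  In any group satisfying the relations,
    [A^alpha, B] = [A, B^alpha]^C, and expanding both sides yields
    A^(q^2) B^(q^2) = 1, so that A^(q^2) is central.  It follows that
      Z = A^(q^2), C^q, A^q, B^q, C, A, B
    successively generate a normal chain with cyclic factors of order at most q,
    so |J| <= q^7.  Conversely, assuming |J| = q^7 the action of A and B on the
    cosets <C> A^i B^j has a closed form, and the permutations of
    Z/q^3 x Z/q^2 it defines do satisfy the relations, so that |J| = q^7 and
    the chain refines the upper central series, with Z_1 = <Z>, Z_2 = <Z, C^q>
    and Z_3 = <Z, C^q, A^q, B^q>, which is abelian.

    Modulo Z_2 write u = A^(q x1) B^(q y1) and v = A^(q x2) B^(q y2), two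
    elements of Z_3.  Then (A u, B v) satisfies the relations if and only if,
    modulo q,
      x1 + 2 y1 + y2 = y1 binom(alpha, 3),  y2 + 2 x2 + x1 = x2 binom(alpha, 3),
    where binom(alpha, 3) = d.  As 2 - d is a unit, (x1, y1) determines
    (x2, y2), and s |-> A^-1 s(A) is a morphism from Aut_3 to
    Z_3 / Z_2 = (Z/q)^2 with kernel Aut_2.  It maps Delta to B^q and C delta to
    A^(l q), hence it is onto.  Finally |Aut_2| = |Z_2|^2 = q^4. *)
Require Import Defs.
From mathcomp Require Import all_boot all_order all_algebra all_fingroup.
From mathcomp Require Import all_solvable zify ring.

Set Implicit Arguments.
Unset Strict Implicit.
Unset Printing Implicit Defensive.
Import GRing.Theory.

(** The argument rests on two numbers being prime to p. In the expansion of [A^alpha, B] =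
    [A, B^alpha]^C the exponents differ by alpha^alpha - (1 + alpha + ... + alpha^(alpha - 1)) = q^2
    u, and B^(q^2) is controlled only because u is a unit; modulo p, 2 u = l^2 (1 - 2 binom(alpha,
    3)). The system for automorphisms needs the unit 2 - binom(alpha, 3). Now p divides binom(alpha,
    3) unless p = 3 and m = 1, when it is l modulo 3. In that case both numbers are divisible by 3
    exactly when l = 2 modulo 3, which the assumption on (alpha - 1)/3 excludes.

    The recurring obstacle is division by 3: for p = 3 and n a power of q, binom(n, 3) lacks a
    factor 3, which a spare factor p elsewhere always supplies.

    Exchanging A and B preserves the relations and inverts C and Z, so each computation is done for
    one generator only.

    Delta comes from the system itself: (x1, y1) = (0, 1) gives y2 = d - 2, then (2 - d) x2 = 2 - d,
    so x2 = 1. Its shape is forced modulo Z_2. *)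

(** * Divisibility of binomial coefficients *)

Lemma dvdn_bin2 n : odd n -> n %| 'C(n, 2).
Proof. by move=> on; rewrite bin2odd // dvdn_mulr. Qed.

Lemma dvdn_3bin3 n : n %| 3 * 'C(n, 3).
Proof. by case: n => // n; rewrite -mul_bin_diag dvdn_mulr. Qed.

Lemma dvdn_3binS3 n : odd n -> n %| 3 * 'C(n.+1, 3).
Proof. by move=> on; rewrite -mul_bin_diag dvdn_mull // dvdn_bin2. Qed.

(** Treats all primes at once: the 3 is absorbed by y when p = 3 and is prime to p otherwise. With x
    = binom(n, 3) it restores the factor 3 missing from the divisibility by n. *)
Lemma dvdn_mul3 p k x y : prime p -> p ^ k %| 3 * x -> p %| y -> p ^ k %| y * x.
Proof.
move=> pp; have [->|n3] := eqVneq p 3.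
  by move=> d3 /dvdnP[z ->]; rewrite -mulnA; exact: dvdn_mull d3.
move=> d _; apply: dvdn_mull.
by rewrite Gauss_dvdr // in d; rewrite coprimeXl ?prime_coprime // dvdn_prime2.
Qed.

Lemma bin2_double n : 'C(n, 2) * 2 = n * n.-1.
Proof. by rewrite bin2 muln2 -[RHS]odd_double_half oddM; case: n => //= n; rewrite andNb. Qed.

(** As 6 binom(x + 1, 3) = x^3 - x, this is the polarization of the cube divided by 3. It gives T
    its addition law even where 3 is not invertible. *)
Lemma binS3D x y : 2 * 'C((x + y).+1, 3) = 2 * 'C(x.+1, 3) + 2 * 'C(y.+1, 3) + x * y * (x + y).
Proof.
elim: y => [|y IH]; first by rewrite addn0 ['C(1, 3)]bin_small // !muln0 !mul0n !addn0.
rewrite addnS binS mulnDr IH [in RHS](binS y.+1).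
have := bin2_double (x + y).+1; have := bin2_double y.+1; rewrite /=; nia.
Qed.

(** * The action on the cosets of <C> *)

(* The model is the action by right multiplication on the cosets <C> A^i B^j.
   Put e = 2 f = l q.  Since C^j A C^-j = A^(alpha^-j) and
   (B^j)^A = C^-j B^(s j), s j = alpha + ... + alpha^j, the generator A maps
   (i, j) to ((i + 1) alpha^-j, s j): modulo e^3, beta_pow j is alpha^-j and
   alpha_sum j is s j, T j standing for e^2 binom(j + 1, 3).  As
   A^(q^2) B^(q^2) = 1, the pair (i, j) only matters modulo the multiples of
   (q^2, q^2), that is, of (f^2, f^2). *)
Section Action.
Local Open Scope ring_scope.
Variables (R : comNzRingType) (f g : R) (T : R -> R).
(** Formally T j = (2/3) f^2 (j^3 - j), which makes no sense when p = 3; hence T is known only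
    through its addition law. The element g = T f is formally -(2/3) f^3: it can be non-zero only
    for p = 3. *)
Hypotheses (f3 : f ^+ 3 = 0) (fg : f * g = 0)
 (TD : forall x y, T (x + y) = T x + T y + 2 * f ^+ 2 * x * y * (x + y))
 (Tf : forall x, T (f * x) = g * x)
 (fT : forall x, exists y, T x = f ^+ 2 * y)
 (T1 : T 1 = 0).

Definition beta_pow (j : R) := 1 - 2 * f * j + 2 * f ^+ 2 * j * (j + 1).
Definition alpha_sum (j : R) := j + f * j * (j + 1) + T j.
Definition act_a (y : R * R) := ((y.1 + 1) * beta_pow y.2, alpha_sum y.2).

(** Since f^3 = 0, the iterates are polynomial in n, binom(n, 2) and binom(n, 3). The formula serves
    at n = q^3 for A^(q^3) = 1, at n = alpha for A^C = A^alpha, and from (0, 0) for transitivity. *)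
Lemma iter_act_a n (i j : R) :
  iter n act_a (i, j) =
  let N := n%:R : R in let b2 := 'C(n, 2)%:R : R in let b3 := 'C(n, 3)%:R : R in
  (i * (1 - 2 * f * N * j - 2 * f ^+ 2 * b2 * j * (j + 1)
       + 2 * f ^+ 2 * N * j * (N * j + 1))
   + N - 2 * f * (b2 + N) * j
   - 4 * f ^+ 2 * (b3 + b2) * j + 2 * f ^+ 2 * (b2 + N) * j * (j + 1),
   j + N * f * j * (j + 1) + N * T j + b2 * (f ^+ 2 * j * (j + 1) * (j + j + 1) + g * j * (j + 1))).
Proof.
elim: n => [|n IH]; first by rewrite /= !bin0n !mulr0n; congr (_, _); ring.
rewrite iterS IH /act_a /= !binS bin1 -[n.+1]addn1 !natrD.
set N := n%:R; set b2 := 'C(n, 2)%:R; set b3 := 'C(n, 3)%:R.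
have [t Tj] := fT j.
have NN : N * N = b2 + b2 + N.
  rewrite /N /b2 -!natrM -!natrD; congr (_%:R).
  have := bin2 n; have := odd_double_half (n * n.-1); rewrite oddM; nia.
clearbody N b2 b3; clear IH.
have [u gu] : exists u, g = f ^+ 2 * u by have [u] := fT (f * 1); rewrite Tf mulr1; exists u.
(* The second coordinate stays congruent to j modulo f: z = j + f w, and every function of z is
   expanded around j. *)
set w := N * j * (j + 1) + N * f * t + b2 * (f * j * (j + 1) * (j + j + 1) + f * u * j * (j + 1)).
set z := j + _ + _ + _.
have zE : z = j + f * w by rewrite /z /w Tj gu; ring.
have Tz : T z = T j + g * N * j * (j + 1).
  rewrite zE TD Tf.
  transitivity (T j + g * w); first by ring: f3.
  by rewrite /w; ring: fg.
have fTj : f * T j = 0 by rewrite Tj; ring: f3.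
have gz : beta_pow z = 1 - 2 * f * (j + f * N * j * (j + 1)) + 2 * f ^+ 2 * j * (j + 1).
  rewrite zE /beta_pow.
  transitivity (1 - 2 * f * (j + f * w) + 2 * f ^+ 2 * j * (j + 1)); first by ring: f3.
  rewrite /w; ring: f3.
have sz : alpha_sum z = z + f * j * (j + 1) + N * f ^+ 2 * j * (j + 1) * (j + j + 1) + T j + g * N * j * (j + 1).
  rewrite /alpha_sum Tz zE.
  transitivity (j + f * w + f * j * (j + 1) + f ^+ 2 * w * (j + j + 1) + (T j + g * N * j * (j + 1))); first by ring: f3.
  rewrite /w; ring: f3.
rewrite gz sz /z; congr (_, _).
ring: NN f3.
ring: f3.
Qed.

Definition alphaR : R := 1 + 2 * f.
Definition betaR : R := 1 - 2 * f + 4 * f ^+ 2.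
Definition act_b (y : R * R) := (y.1, y.2 + 1).
Definition act_c (y : R * R) := (alphaR * y.1, betaR * y.2).
Definition act_cV (y : R * R) := (betaR * y.1, alphaR * y.2).

Lemma mul_alpha_beta : alphaR * betaR = 1.
Proof. by rewrite /alphaR /betaR; ring: f3. Qed.

Lemma act_cK : cancel act_c act_cV.
Proof. by case=> i j; rewrite /act_c /act_cV /= !mulrA [betaR * alphaR]mulrC mul_alpha_beta !mul1r. Qed.

(** This is AB = BA[A, B] for a right action, the leftmost factor acting first. *)
Lemma act_a_b y : act_b (act_a y) = act_c (act_a (act_b y)).
Proof.
case: y => i j; rewrite /act_a /act_b /act_c /alpha_sum /= TD T1 /alphaR /betaR /beta_pow.
have [t Tj] := fT j.
rewrite Tj; congr (_, _); ring: f3.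
Qed.

Definition eq_mod_f2 (y z : R * R) := exists w, z = (y.1 + f ^+ 2 * w, y.2 + f ^+ 2 * w).

Lemma act_a_eq y z : eq_mod_f2 y z -> eq_mod_f2 (act_a y) (act_a z).
Proof.
case: y => i j [w ->] /=; exists w; rewrite /act_a /beta_pow /alpha_sum /= TD.
have -> : T (f ^+ 2 * w) = 0.
  by rewrite expr2 -mulrA Tf; ring: fg.
congr (_, _); ring: f3.
Qed.

Lemma act_c_eq y z : eq_mod_f2 y z -> eq_mod_f2 (act_c y) (act_c z).
Proof.
by case: y => i j [w ->] /=; exists w; rewrite /act_c /alphaR /betaR /=; congr (_, _); ring: f3.
Qed.

Lemma act_b_eq y z : eq_mod_f2 y z -> eq_mod_f2 (act_b y) (act_b z).
Proof. by case: y => i j [w ->] /=; exists w; rewrite /act_b /= addrAC. Qed.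

(** The relation A^C = A^alpha holds only up to the identification of pairs: the two sides differ by
    (f^2 w, f^2 w) with w = (2 u - 2) j, where g = f^2 u. *)
Lemma iter_act_a_alpha n y : n%:R = alphaR -> 'C(n, 2)%:R = f * alphaR ->
    2 * f ^+ 2 * 'C(n, 3)%:R = g ->
  eq_mod_f2 (iter n act_a y) (act_c (act_a (act_cV y))).
Proof.
case: y => i j n1 n2 n3; rewrite iter_act_a /= n1 n2.
have [u gu] : exists u, g = f ^+ 2 * u by have [u] := fT (f * 1); rewrite Tf mulr1; exists u.
have [t Tj] := fT j.
have Talj : T (alphaR * j) = T j + 2 * g * j.
  have -> : alphaR * j = j + f * (2 * j) by rewrite /alphaR; ring.
  by rewrite TD Tf; ring: f3.
exists ((2 * u - 2) * j); rewrite /act_a /act_c /beta_pow /alpha_sum /= Talj.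
set b3 := 'C(n, 3)%:R in n3 *; clearbody b3.
have -> : 4 * f ^+ 2 * (b3 + f * alphaR) * j = 2 * g * j.
  by rewrite -n3; ring: f3.
have -> : f ^+ 2 * ((2 * u - 2) * j) = 2 * g * j - 2 * f ^+ 2 * j.
  by rewrite gu; ring.
rewrite /alphaR /betaR Tj; congr (_, _); first by ring: f3.
ring: f3 fg.
Qed.

End Action.

(** * The permutation model on Z/q^3 x Z/q^2 *)

Section Model.
Variables (p m ell : nat).
Hypotheses (pp : prime p) (p_odd : odd p) (m_gt0 : 0 < m) (ellp : ~~ (p %| ell)).
Let q := p ^ m.
Let N := q ^ 3.
(** The inverse of 2 modulo N, so that f below is l q / 2. *)
Let h := N.+1./2.

Lemma odd_q : odd q. Proof. by rewrite oddX p_odd orbT. Qed.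
Lemma odd_N : odd N. Proof. by rewrite oddX odd_q orbT. Qed.
Lemma q_gt1 : 1 < q. Proof. by rewrite -(expn0 p) ltn_exp2l ?prime_gt1. Qed.
Lemma N_gt1 : 1 < N. Proof. by rewrite -(expn0 q) ltn_exp2l ?q_gt1. Qed.
Lemma double_h : 2 * h = N.+1.
Proof. by rewrite mul2n -[RHS]odd_double_half /= odd_N. Qed.
Lemma N_expn : N = p ^ (3 * m).
Proof. by rewrite /N /q -expnM mulnC. Qed.
Lemma p_dvd_q : p %| q. Proof. by rewrite dvdn_exp. Qed.

Local Open Scope ring_scope.
Let R := 'Z_N.
Let f : R := (ell * q * h)%:R.

Lemma natN : N%:R = 0 :> R.
Proof. by rewrite -[in RHS](@pchar_Zp N) ?N_gt1. Qed.
Lemma natr_dvd n : (N %| n)%N -> n%:R = 0 :> R.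
Proof. by case/dvdnP=> k ->; rewrite natrM natN mulr0. Qed.

Lemma double_f : 2 * f = (ell * q)%:R.
Proof. by rewrite /f -natrM mulnCA double_h mulnS natrD (natr_dvd (dvdn_mull _ (dvdnn N))) addr0. Qed.
Lemma double_half : 2 * h%:R = 1 :> R.
Proof. by rewrite -natrM double_h -natr1 natN add0r. Qed.
Lemma f_cube : f ^+ 3 = 0.
Proof. by rewrite -natrX natr_dvd // !expnMn -mulnA dvdn_mull // dvdn_mulr. Qed.

Definition tn (n : nat) : R := 4 * f ^+ 2 * 'C(n.+1, 3)%:R.
Lemma tnD x y : tn (x + y) = tn x + tn y + 2 * f ^+ 2 * x%:R * y%:R * (x%:R + y%:R).
Proof.
have E : 2 * 'C((x + y).+1, 3)%:R = 2 * 'C(x.+1, 3)%:R + 2 * 'C(y.+1, 3)%:R + x%:R * y%:R * (x%:R + y%:R) :> R.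
  by rewrite -!natrD -!natrM -!natrD binS3D.
have D (a : R) : 4 * f ^+ 2 * a = 2 * f ^+ 2 * (2 * a) by ring.
by rewrite /tn !D E; ring.
Qed.
(** Makes T well defined on residues modulo N: N divides 3 binom(N + 1, 3), and f^2 supplies the
    factor 3 when p = 3. *)
Lemma tnN : tn N = 0.
Proof.
rewrite /tn /f -!natrX -!natrM natr_dvd //.
rewrite N_expn; apply: dvdn_mul3 => //; first by rewrite -N_expn dvdn_3binS3 ?odd_N.
by rewrite dvdn_mull // expnMn dvdn_mulr // expnMn dvdn_mull // dvdn_exp ?p_dvd_q.
Qed.
Lemma tnMN k : tn (k * N) = 0.
Proof.
elim: k => [|k IH]; first by rewrite mul0n /tn mulr0.
by rewrite mulSn tnD IH tnN natN mulr0 !mul0r !addr0.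
Qed.
Lemma tn_mod n : tn (n %% N) = tn n.
Proof.
by rewrite [in RHS](divn_eq n N) tnD tnMN natrM natN !mulr0 !mul0r add0r addr0.
Qed.

Definition T (x : R) : R := tn x.
Lemma Tnat n : T n%:R = tn n.
Proof. by rewrite /T val_Zp_nat ?N_gt1 // tn_mod. Qed.
Lemma natr_val (x : R) : (val x)%:R = x.
Proof. exact: natr_Zp. Qed.
Lemma TD (x y : R) : T (x + y) = T x + T y + 2 * f ^+ 2 * x * y * (x + y).
Proof. by rewrite -(natr_val x) -(natr_val y) -natrD !Tnat tnD natrD. Qed.
Lemma T0 : T 0 = 0. Proof. by rewrite /T /tn mulr0. Qed.
Lemma Tf x : T (f * x) = T f * x.
Proof.
rewrite -(natr_val x); elim: (val x) => [|n IH]; first by rewrite !mulr0 T0.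
by rewrite -natr1 mulrDr mulr1 TD IH; ring: f_cube.
Qed.
Lemma fT x : exists y, T x = f ^+ 2 * y.
Proof. by rewrite /T /tn; eexists; rewrite [4 * _]mulrC -mulrA; reflexivity. Qed.
Lemma fg : f * T f = 0.
Proof. by have [y ->] := fT f; ring: f_cube. Qed.
Lemma T1 : T 1 = 0.
Proof. by rewrite -[1]/(1%:R) Tnat /tn mulr0. Qed.

Lemma iter_act_aN y : iter N (act_a f T) y = y.
Proof.
case: y => i j; rewrite (iter_act_a f_cube fg TD Tf fT) /=.
rewrite natN (natr_dvd (dvdn_bin2 odd_N)).
have E : f ^+ 2 * 'C(N, 3)%:R = 0.
  rewrite /f -!natrX -!natrM natr_dvd // N_expn; apply: dvdn_mul3 => //; first by rewrite -N_expn dvdn_3bin3.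
  by rewrite expnMn dvdn_mulr // expnMn dvdn_mull // dvdn_exp ?p_dvd_q.
by congr (_, _); ring: E.
Qed.

Lemma iter_alpha y : eq_mod_f2 f (iter (1 + ell * q) (act_a f T) y) (act_c f (act_a f T (act_cV f y))).
Proof.
set al := (1 + _)%N.
have a1 : al%:R = 1 + 2 * f by rewrite double_f natrD.
apply: (iter_act_a_alpha f_cube fg TD Tf fT) => //.
- have B : 2 * 'C(al, 2)%:R = al%:R * (2 * f).
    by rewrite double_f -!natrM mulnC bin2_double /al add1n.
  have E (x : R) : x = h%:R * (2 * x) by rewrite mulrCA mulrA double_half mul1r.
  rewrite [LHS]E B a1 [RHS]E; congr (_ * _); rewrite /alphaR; ring.
- have B : 2 * T f = 2 * (2 * f ^+ 2 * 'C(al, 3)%:R).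
    have -> : 2 * T f = T (2 * f) by rewrite [2 * f]mulrC Tf; ring.
    rewrite double_f Tnat /tn /al add1n; ring.
  have E (x : R) : x = h%:R * (2 * x) by rewrite mulrCA mulrA double_half mul1r.
  by rewrite [LHS]E -B -E.
Qed.

Let X : finType := ('Z_N * 'Z_(q ^ 2))%type.
Let M := (q ^ 2)%N.
Lemma M_gt1 : (1 < M)%N. Proof. by rewrite -(expn0 q) ltn_exp2l ?q_gt1. Qed.
Lemma M_dvd_N : (M %| N)%N. Proof. by rewrite dvdn_exp2l. Qed.

Definition residue (x : R) : 'Z_M := (val x)%:R.
Lemma natr_eqZ k a b : (1 < k)%N -> (a%:R == b%:R :> 'Z_k) = (a == b %[mod k]).
Proof. by move=> k1; rewrite -val_eqE /= !val_Zp_nat. Qed.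
Lemma residue_nat n : residue n%:R = n%:R.
Proof.
apply/eqP; rewrite /residue natr_eqZ ?M_gt1 //.
have -> : val (n%:R : R) = (n %% N)%N := val_Zp_nat N_gt1 n.
by rewrite modn_dvdm ?M_dvd_N.
Qed.
Lemma residueD x y : residue (x + y) = residue x + residue y.
Proof. by rewrite -(natr_val x) -(natr_val y) -natrD !residue_nat natrD. Qed.
Lemma residueM x y : residue (x * y) = residue x * residue y.
Proof. by rewrite -(natr_val x) -(natr_val y) -natrM !residue_nat natrM. Qed.

Lemma residue_f2 x : residue (f ^+ 2 * x) = 0.
Proof.
rewrite residueM -natrX residue_nat; apply/eqP.
rewrite (_ : (_ ^ 2)%:R = 0) ?mul0r //; apply/eqP.
rewrite -[0]/(0%:R) natr_eqZ ?M_gt1 //.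
by rewrite mod0n -/(dvdn _ _) !expnMn dvdn_mulr // dvdn_mull.
Qed.

(** As 2 f = l q and l has an inverse u modulo N, the witness is 4 u^2. *)
Lemma dvd_f2 : exists w, M%:R = f ^+ 2 * w.
Proof.
have co : coprime ell N by rewrite N_expn coprime_sym coprimeXl // prime_coprime.
have l0 : (0 < ell)%N by case: (ell) ellp; rewrite ?dvdn0.
case: (egcdnP N l0) => u v e1 _.
have e2 : u%:R * ell%:R = 1 :> R.
  by rewrite -natrM e1 (eqnP co) natrD natrM natN mulr0 add0r.
exists (4 * u%:R ^+ 2).
transitivity ((u%:R * (2 * f)) ^+ 2); last by ring.
by rewrite double_f natrM mulrA e2 mul1r natrX.
Qed.

Lemma residue_eq x y : residue x = residue y -> exists w, y = x + f ^+ 2 * w.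
Proof.
move=> e; have [w0 Mw] := dvd_f2.
suff [w yw] : exists w, y - x = M%:R * w.
  by exists (w0 * w); rewrite mulrA -Mw -yw addrC subrK.
have : residue (y - x) = 0.
  by apply: (addIr (residue x)); rewrite -residueD subrK add0r.
rewrite -{2}(natr_val (y - x)) /residue => /eqP.
rewrite -[0]/(0%:R) natr_eqZ ?M_gt1 // mod0n => /dvdnP[k ->].
by exists k%:R; rewrite natrM mulrC.
Qed.

(** The values i - j and j modulo q^2 determine (i, j) exactly up to multiples of (q^2, q^2), so X
    is the quotient of the pairs by [eq_mod_f2]. *)
Definition proj (y : R * R) : X := (y.1 - y.2, residue y.2).
Definition sec (x : X) : R * R := (x.1 + (val x.2)%:R, (val x.2)%:R).
Lemma secK x : proj (sec x) = x.
Proof. by case: x => a b; rewrite /proj /sec /= addrK residue_nat natr_Zp. Qed.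

Lemma proj_eq y z : proj y = proj z <-> eq_mod_f2 f y z.
Proof.
case: y z => [a b] [c d]; split=> [e|[w [-> ->]]].
  have e1 : a - b = c - d := congr1 fst e.
  have [w e2] := residue_eq (congr1 snd e : residue b = residue d).
  exists w; rewrite /= -e2; congr (_, _).
  by rewrite -[c](subrK d) -e1 e2; ring.
rewrite /proj /= residueD residue_f2 addr0; congr (_, _); ring.
Qed.

Section Descend.
Variables (F : R * R -> R * R).
Hypotheses (Feq : forall y z, eq_mod_f2 f y z -> eq_mod_f2 f (F y) (F z)).
Definition descend (x : X) := proj (F (sec x)).
Lemma descend_proj y : descend (proj y) = proj (F y).
Proof. by apply/proj_eq/Feq/proj_eq; rewrite secK. Qed.
Lemma iter_descend n y : iter n descend (proj y) = proj (iter n F y).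
Proof. by elim: n => //= n ->; rewrite descend_proj. Qed.
(** A map with F^(n + 1) = 1 upstairs is inverted downstairs by the n-th iterate. *)
Lemma descend_inj n : (forall y, iter n.+1 F y = y) -> injective descend.
Proof.
move=> Fn; apply: (@can_inj _ _ _ (iter n descend)) => x.
by rewrite -[X in iter _ _ (descend X)]secK -iterSr iter_descend Fn secK.
Qed.
End Descend.

Let f_cube' := f_cube.
Let a_eq := act_a_eq f_cube fg TD Tf.
Let b_eq := @act_b_eq R f.
Let c_eq := act_c_eq f_cube.

Lemma iter_act_b n (y : R * R) : iter n (@act_b R) y = (y.1, y.2 + n%:R).
Proof.
case: y => i j; elim: n => [|n IH]; first by rewrite addr0.
by rewrite iterS IH /act_b /= -addrA natr1.
Qed.

Lemma N_S : N = N.-1.+1. Proof. by rewrite prednK // ltnW ?N_gt1. Qed.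

Lemma perm_a_inj : injective (descend (act_a f T)).
Proof. by apply: (descend_inj a_eq (n := N.-1)) => y; rewrite -N_S iter_act_aN. Qed.
Lemma perm_b_inj : injective (descend (@act_b R)).
Proof.
apply: (descend_inj b_eq (n := N.-1)) => y; rewrite -N_S iter_act_b natN addr0.
by case: y.
Qed.
Lemma perm_c_inj : injective (descend (act_c f)).
Proof.
have cV_eq y z : eq_mod_f2 f y z -> eq_mod_f2 f (act_cV f y) (act_cV f z).
  by case: y => i j [w ->] /=; exists w; rewrite /act_cV /alphaR /betaR /=; congr (_, _); ring: f_cube'.
apply: (@can_inj _ _ _ (descend (act_cV f))) => x.
by rewrite -{1}[x]secK (descend_proj c_eq) (descend_proj cV_eq) (act_cK f_cube) secK.
Qed.

Definition perm_a : {perm X} := perm perm_a_inj.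
Definition perm_b : {perm X} := perm perm_b_inj.
Definition perm_c : {perm X} := perm perm_c_inj.

Local Open Scope group_scope.

Lemma comm_perm : [~ perm_a, perm_b] = perm_c.
Proof.
rewrite commgEl; apply: (mulgI perm_a); rewrite mulKVg.
rewrite conjgE; apply: (mulgI perm_b); rewrite !mulgA mulgV mul1g -!mulgA.
apply/permP => x; rewrite !permM !permE /= -[x]secK.
by rewrite !(descend_proj a_eq, descend_proj b_eq, descend_proj c_eq) (act_a_b f_cube TD fT T1).
Qed.

Lemma model_rel : J_relations p m (1 + ell * q) perm_a perm_b.
Proof.
have pbX n : perm_b ^+ n =1 iter n (descend (@act_b R)).
  by move=> x; rewrite permX; apply: eq_iter => y; rewrite permE.
have paX n : perm_a ^+ n =1 iter n (descend (act_a f T)).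
  by move=> x; rewrite permX; apply: eq_iter => y; rewrite permE.
rewrite /J_relations -[ [~ perm_b, perm_a]]invg_comm comm_perm -N_expn; split.
- apply: (mulgI perm_c); rewrite -conjgC; apply/permP => x; rewrite !permM !permE paX -[x]secK.
  rewrite !(descend_proj a_eq, descend_proj c_eq, iter_descend a_eq); apply/esym/proj_eq.
  by rewrite -{2}[sec x](act_cK f_cube); apply: iter_alpha.
- apply: (mulgI perm_c^-1); rewrite -conjgC; apply: (mulgI perm_c); rewrite mulKVg.
  apply: (mulIg perm_c); rewrite mulgA mulgKV.
  apply/permP => x; rewrite !permM !permE pbX -[x]secK.
  rewrite !(descend_proj b_eq, descend_proj c_eq, iter_descend b_eq); congr proj.
  rewrite iter_act_b /act_b /act_c /= (_ : (1 + _)%:R = alphaR f); last first.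
    by rewrite /alphaR double_f natrD.
  by congr (_, _); rewrite mulrDr [(betaR f * alphaR f)%R]mulrC (mul_alpha_beta f_cube).
- apply/permP => x; rewrite paX perm1 -[x]secK (iter_descend a_eq) iter_act_aN //.
- apply/permP => x; rewrite pbX perm1 -[x]secK (iter_descend b_eq) iter_act_b natN addr0.
  by case: (sec x).
Qed.

(** The powers of C carry (1, 0) to (alpha^k, 0), and alpha^k = 1 modulo q^3 forces q^2 to divide
    k. *)
Lemma order_perm_c : (M <= #[perm_c])%N.
Proof.
apply: dvdn_leq; first exact: order_gt0.
have : perm_c ^+ #[perm_c] = 1 by apply: expg_order.
move: #[perm_c] => k pk.
have pcX : iter k (descend (act_c f)) (proj (1, 0))%R = proj (1, 0)%R.
  rewrite -[RHS](perm1 (proj (1, 0))%R) -pk permX; apply: eq_iter => y.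
  by rewrite permE.
rewrite (iter_descend c_eq) in pcX.
have itc n : iter n (act_c f) (1, 0)%R = ((alphaR f ^+ n)%R, 0%R).
  elim: n => //= n ->; rewrite /act_c /= mulr0 exprS //.
have E : (alphaR f ^+ k)%R = 1%R.
  by have := congr1 fst pcX; rewrite itc /= !subr0.
have B n : (alphaR f ^+ n = 1 + 2 * f * n%:R + 2 * f ^+ 2 * n%:R * (n%:R - 1))%R.
  elim: n => [|n IH]; first by rewrite expr0; ring.
  by rewrite exprS IH /alphaR -natr1; ring: f_cube'.
(* Here alpha^k - 1 = 2 f k (1 + f (k - 1)), and the cofactor is the inverse of 1 + f (k - 1). *)
have E2 : (2 * f * k%:R = 0)%R.
  transitivity ((alphaR f ^+ k - 1) * (1 - f * (k%:R - 1) + f ^+ 2 * (k%:R - 1) ^+ 2))%R.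
    by rewrite B; ring: f_cube'.
  by rewrite E subrr mul0r.
move: E2; rewrite double_f -natrM => /eqP; rewrite -[0%R]/(0%:R)%R natr_eqZ ?N_gt1 // mod0n.
rewrite -/(dvdn _ _) /N expnSr mulnAC dvdn_pmul2r; last by rewrite ltnW ?q_gt1.
by rewrite Gauss_dvdr // /M /q -expnM coprimeXl // prime_coprime.
Qed.

(** Orbit-stabilizer: A^i B^j moves the base point to (i, j), so the q^5 points form one orbit, and
    C, of order at least q^2, fixes the base point. *)
Lemma model_card (G : {group {perm X}}) : perm_a \in G -> perm_b \in G -> (q ^ 7 <= #|G|)%N.
Proof.
move=> Ga Gb.
have Gc : perm_c \in G by rewrite -comm_perm groupR.
pose x0 := proj (0, 0)%R.
have orb : orbit 'P G x0 = [set: X].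
  apply/setP => x; rewrite inE -[x]secK; move: (sec x) => [i j].
  apply/orbitP; exists (perm_a ^+ val i * perm_b ^+ val j); first by rewrite groupM ?groupX.
  rewrite /= /aperm permM !permX.
  have -> : iter (val i) perm_a x0 = proj (i, 0)%R.
    rewrite -(eq_iter (f := descend (act_a f T))); last by move=> y; rewrite permE.
    rewrite (iter_descend a_eq) (iter_act_a f_cube fg TD Tf fT) /= T0 natr_val; congr (proj (_, _)); ring.
  rewrite -(eq_iter (f := descend (@act_b R))); last by move=> y; rewrite permE.
  by rewrite (iter_descend b_eq) iter_act_b /= natr_val add0r.
have st : <[perm_c]> \subset 'C_G[x0 | 'P].
  rewrite cycle_subG inE Gc; apply/astab1P; rewrite /= /aperm permE /x0.
  by rewrite (descend_proj c_eq) /act_c /= !mulr0.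
rewrite -(card_orbit_stab 'P G x0) orb cardsT card_prod !card_ord.
rewrite !Zp_cast ?N_gt1 ?M_gt1 // (expnD q 5 2) leq_mul //.
  by rewrite -expnD.
by apply: leq_trans (subset_leq_card st); apply: order_perm_c.
Qed.
End Model.

(** * Powers of alpha *)

Local Open Scope nat_scope.
Definition geo (a n : nat) := \sum_(i < n) a ^ i.
Lemma geoS a n : geo a n.+1 = 1 + a * geo a n.
Proof.
rewrite /geo big_ord_recl expn0 big_distrr; congr (_ + _).
by apply: eq_bigr => i _; rewrite /= expnS.
Qed.
Lemma geo0 a : geo a 0 = 0. Proof. by rewrite /geo big_ord0. Qed.

Lemma geo_expn e n : (1 + e) ^ n = 1 + e * geo (1 + e) n.
Proof.
elim: n => [|n IH]; first by rewrite geo0 muln0.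
rewrite expnS {1}IH geoS; ring.
Qed.

Lemma geo_expand e n :
  exists k, geo (1 + e) n = n + 'C(n, 2) * e + 'C(n, 3) * e ^ 2 + e ^ 3 * k.
Proof.
elim: n => [|n [k IH]]; first by exists 0; rewrite geo0 !bin0n !muln0.
exists ('C(n, 3) + (1 + e) * k).
by rewrite geoS IH !binS bin1 -[n.+1]addn1; ring.
Qed.

Lemma modn_coprime_inj k n x y : coprime k n -> k * x = k * y %[mod n] -> x = y %[mod n].
Proof.
move=> co e; have [k0|k0] := posnP k.
  by move: co; rewrite k0 /coprime gcd0n => /eqP->; rewrite !modn1.
case: (egcdnP n k0) => v w E _.
have F z : z = v * (k * z) %[mod n].
  by rewrite mulnA E (eqnP co) mulnDl mul1n -mulnA mulnCA mulnC modnMDl.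
by rewrite (F x) (F y) -modnMmr e modnMmr.
Qed.

Section Arith.
Variables (p m ell : nat).
Hypotheses (pp : prime p) (p_odd : odd p) (m_gt0 : 0 < m) (ellp : ~~ (p %| ell)).
Hypothesis ell3 : p = 3 -> m = 1 -> ell = 1 %[mod 3].
Let q := p ^ m.
Let al := 1 + ell * q.
Let c3 := 'C(al, 3).

(** In the expansion of the geometric sum, n divides binom(n, 2) because it is odd, and it divides q
    binom(n, 3) up to the prime-to-p factor or the 3 taken from q. *)
Lemma geo_q n : n = q \/ n = q ^ 2 -> exists k, geo al n = n + n * q * k.
Proof.
move=> nq; have [k ->] := geo_expand (ell * q) n.
have on : odd n by case: nq => ->; rewrite ?oddX p_odd ?orbT.
have [i ->] := dvdnP (dvdn_bin2 on).
have [x nE] : exists x, n = p ^ x by case: nq => ->; [exists m | exists (m * 2); rewrite expnM].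
have [j cE] : exists j, ell ^ 2 * q * 'C(n, 3) = n * j.
  have /dvdnP[j ->] : n %| ell ^ 2 * q * 'C(n, 3).
    by rewrite nE; apply: dvdn_mul3; rewrite // -?nE ?dvdn_3bin3 // dvdn_mull // (p_dvd_q p m_gt0).
  by exists j; rewrite mulnC.
have [w qE] : exists w, q ^ 2 = n * w.
  by case: nq => ->; [exists q | exists 1]; rewrite ?muln1 ?mulnn.
exists (i * ell + j + ell ^ 3 * w * k).
have -> : 'C(n, 3) * (ell * q) ^ 2 = q * (ell ^ 2 * q * 'C(n, 3)) by ring.
have -> : (ell * q) ^ 3 * k = q * (q ^ 2) * (ell ^ 3 * k) by ring.
rewrite cE qE; ring.
Qed.

Lemma alpha_expn_q : exists k, al ^ q = 1 + ell * q ^ 2 + q ^ 3 * k.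
Proof.
have [k e] := geo_q (or_introl (erefl q)).
by exists (ell * k); rewrite geo_expn e; ring.
Qed.

Lemma bin3_alpha : 6 * c3 + ell * q = (ell * q) ^ 3.
Proof.
rewrite /c3 /al add1n; elim: (ell * q) => [//|n IH].
transitivity ((6 * 'C(n.+1, 3) + n) + 3 * ('C(n.+1, 2) * 2) + 1); first by rewrite binS; ring.
by rewrite IH bin2_double /=; ring.
Qed.

Lemma p_neq2 : p != 2. Proof. by apply: contraTneq p_odd => ->. Qed.
Lemma q_gt0 : 0 < q. Proof. by rewrite expn_gt0 prime_gt0. Qed.
Lemma ell_gt0 : 0 < ell. Proof. by case: (ell) ellp; rewrite ?dvdn0. Qed.

Definition bin3_alpha_res := if p == 3 then 3 ^ (m - 1) * ell else 0.

(** With e = l q, 6 binom(alpha, 3) = e^3 - e, which settles p > 3. If p = 3 and q = 3 t, division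
    by 3 gives 2 binom(alpha, 3) = - t l = 2 (t l) modulo 3 t. This is the origin of d = t l. *)
Lemma bin3_alpha_mod : c3 = bin3_alpha_res %[mod q].
Proof.
have E := bin3_alpha; rewrite /bin3_alpha_res; case: eqP => [p3|p3].
  have qE : q = 3 * 3 ^ (m - 1) by rewrite /q p3 -expnS subn1 prednK.
  set t := 3 ^ (m - 1) in qE *.
  apply: (@modn_coprime_inj 2); first by rewrite coprime2n oddX p_odd orbT.
    apply/eqP; rewrite -(eqn_modDr (t * ell)) -mulSnr mulnA -qE.
    have -> : 2 * c3 + t * ell = q * (ell ^ 3 * q * t).
      apply/eqP; rewrite -(eqn_pmul2l (isT : 0 < 3)); apply/eqP.
      transitivity (6 * c3 + ell * (3 * t)); first by ring.
      rewrite -qE E; transitivity (ell ^ 3 * q * q * q); first by ring.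
      by rewrite {3}qE; ring.
    by rewrite modnMr modnMr.
apply/eqP; rewrite mod0n -/(dvdn _ _) .
have c6 : coprime q 6.
  rewrite coprimeXl // prime_coprime // (_ : 6 = 2 * 3) // Euclid_dvdM // !dvdn_prime2 //.
  by rewrite negb_or p_neq2; apply/eqP.
rewrite -(Gauss_dvdr _ c6) -(dvdn_addl _ (dvdn_mull ell (dvdnn q))).
by rewrite E expnMn dvdn_mull // dvdn_exp.
Qed.

Lemma bin3_alpha_modp : p %| c3 \/ [/\ p = 3, c3 = 1 %[mod 3] & ell = 1 %[mod 3]].
Proof.
have E : c3 = bin3_alpha_res %[mod p].
  by rewrite -(modn_dvdm c3 (p_dvd_q p m_gt0)) bin3_alpha_mod modn_dvdm // (p_dvd_q p m_gt0).
move: E; rewrite /bin3_alpha_res; case: eqP => [p3|_] E; last by left; rewrite /dvdn E mod0n.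
have [m1|m1] := leqP m 1; last first.
  left; rewrite /dvdn E p3 -/(dvdn _ _) dvdn_mulr // dvdn_exp // subn_gt0 //.
have m1' : m = 1 by apply/eqP; rewrite eqn_leq m1.
have l3 := ell3 p3 m1'.
by right; split => //; rewrite -l3 -p3 E m1' subnn expn0 mul1n.
Qed.

(** Reduced modulo p, the two cases of [bin3_alpha_modp] give 2 u = l^2 and 2 u = - l^2, neither of
    which vanishes. *)
Lemma alpha_expn_alpha : exists2 u, al ^ al = geo al al + q ^ 2 * u & coprime u q.
Proof.
have [k gE] := geo_expand (ell * q) al.
have b2 : 'C(al, 2) * 2 = (ell * q) * (1 + ell * q).
  by rewrite bin2_double /al add1n /= mulnC.
rewrite -/al -/c3 in gE.
set r := geo al al in gE *.
set e := ell * q in gE b2.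
have e0 : 0 < e by rewrite muln_gt0 ell_gt0 q_gt0.
have aE : al ^ al = 1 + e * r by rewrite geo_expn.
have alE : al = 1 + e by [].
have r2 : 2 * r = 2 * (1 + e) + e ^ 2 * (1 + e) + 2 * c3 * e ^ 2 + 2 * e ^ 3 * k.
  transitivity (2 * (1 + e) + ('C(al, 2) * 2) * e + 2 * c3 * e ^ 2 + 2 * e ^ 3 * k).
    by rewrite gE alE; ring.
  by rewrite b2; ring.
have [N NE] : exists N, al ^ al = r + N.
  by exists (al ^ al - r); rewrite subnKC // aE add1n leqW // leq_pmull.
(* This is 2 N = 2 (1 + e r - r) with the negative terms moved to the left. *)
have E1 : 2 * N + e ^ 2 * (2 * c3 + 2 * e * k) = e ^ 2 * (1 + e ^ 2 + 2 * c3 * e + 2 * e ^ 2 * k).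
  apply: (@addnI (2 * r)); rewrite addnA -mulnDr -NE aE mulnDr mulnCA r2.
  ring.
have q2N : q ^ 2 %| N.
  have q2e z : q ^ 2 %| e ^ 2 * z by rewrite /e expnMn dvdn_mulr // dvdn_mull.
  have : q ^ 2 %| 2 * N by rewrite -(dvdn_addl _ (q2e (2 * c3 + 2 * e * k))) E1.
  by rewrite Gauss_dvdr // coprime_sym coprime2n !oddX p_odd orbT.
have [u uE] := dvdnP q2N.
exists u; first by rewrite NE uE mulnC.
have E2 : 2 * u + ell ^ 2 * (2 * c3 + 2 * e * k) = ell ^ 2 * (1 + e ^ 2 + 2 * c3 * e + 2 * e ^ 2 * k).
  have q2_gt0 : 0 < q ^ 2 by rewrite expn_gt0 q_gt0.
  apply/eqP; rewrite -(eqn_pmul2l q2_gt0); apply/eqP.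
  move: E1; rewrite uE; set W1 := 2 * c3 + _; set W2 := 1 + _ + _ + _ => E1.
  transitivity (2 * (u * q ^ 2) + e ^ 2 * W1); first by rewrite /e; ring.
  by rewrite E1 /e; ring.
rewrite coprime_sym coprimeXl // prime_coprime //; apply/negP => pu.
have [e' eE] : exists e', e = p * e'.
  by have [z qz] := dvdnP (p_dvd_q p m_gt0); exists (ell * z); rewrite /e /q qz; ring.
have [u' uE'] := dvdnP pu.
set Y := e ^ 2 + 2 * c3 * e + 2 * e ^ 2 * k.
have YE : Y = p * (e' * (e + 2 * c3 + 2 * e * k)) by rewrite mulnA -eE /Y; ring.
have E3 : p * (2 * u') + ell ^ 2 * (2 * c3 + p * (2 * e' * k)) = ell ^ 2 * (1 + Y).
  transitivity (ell ^ 2 * (1 + e ^ 2 + 2 * c3 * e + 2 * e ^ 2 * k)); last by rewrite /Y; ring.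
  by rewrite -E2 uE' eE; ring.
case: bin3_alpha_modp => [/dvdnP[c' c3E]|[p3 c31 l1]].
  have : p %| ell ^ 2 * (1 + Y).
    rewrite -E3 c3E; apply: dvdn_add; first exact: dvdn_mulr.
    by apply/dvdn_mull/dvdn_add; [rewrite mulnA dvdn_mull | apply: dvdn_mulr].
  rewrite Gauss_dvdl; first by rewrite Euclid_dvdX // (negPf ellp).
  rewrite prime_coprime // YE dvdn_addl ?dvdn_mulr //.
  by rewrite dvdn1 neq_ltn prime_gt1 ?orbT.
have c3E : c3 = 3 * (c3 %/ 3) + 1 by rewrite {1}(divn_eq c3 3) c31 mulnC.
have : 3 %| ell ^ 2.
  rewrite YE p3 c3E in E3; move: E3; set c' := _ %/ 3; set Z := e' * _; set L := ell ^ 2 => E3.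
  rewrite -(dvdn_addl L (dvdn_mulr (2 * u' + L * (2 * c' + 2 * e' * k)) (dvdnn 3))).
  apply/dvdnP; exists (L * Z); apply: (@addnI L).
  transitivity (L * (1 + 3 * Z)); last by ring.
  by rewrite -E3; ring.
by rewrite Euclid_dvdX // -p3 (negPf ellp).
Qed.
End Arith.

Local Open Scope group_scope.
(** Exchanging A and B turns C into C^-1 and, by [Bq2], Z into Z^-1. Facts about B are obtained
    below by applying those about A to the exchanged pair. *)
Lemma J_relations_sym p m al (gT : groupType) (a b : gT) :
  J_relations p m al a b -> J_relations p m al b a.
Proof. by case=> *; split. Qed.

(** * Consequences of the relations *)

Section Relations.
Variables (p m ell : nat).
Hypotheses (pp : prime p) (p_odd : odd p) (m_gt0 : (0 < m)%N) (ellp : ~~ (p %| ell)).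
Hypothesis ell3 : p = 3 -> m = 1%N -> ell = 1 %[mod 3].
Local Notation q := (p ^ m)%N.
Local Notation al := (1 + ell * q)%N.
Local Notation rel := (J_relations p m al).
Local Notation r := (geo al).

Section Conjugation.
Variables (gT : finGroupType) (A B : gT).
Hypothesis relAB : rel A B.
Local Notation C := [~ A, B].

Lemma AJC : A ^ C = A ^+ al. Proof. by case: relAB. Qed.
Lemma BJCV : B ^ C^-1 = B ^+ al. Proof. by rewrite invg_comm; case: relAB. Qed.
Lemma Aq3 : A ^+ (q ^ 3) = 1. Proof. by case: relAB => _ _; rewrite -expnM mulnC. Qed.
Lemma Bq3 : B ^+ (q ^ 3) = 1. Proof. by case: relAB => _ _ _; rewrite -expnM mulnC. Qed.

Lemma AJB : A ^ B = A * C. Proof. by rewrite commgEl mulKVg. Qed.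

Lemma AnJCk n k : (A ^+ n) ^ (C ^+ k) = A ^+ (n * al ^ k).
Proof.
rewrite conjXg mulnC expgM; congr (_ ^+ n).
elim: k => [|k IH]; first by rewrite conjg1.
by rewrite expgSr conjgM IH conjXg AJC -expgM expnSr mulnC.
Qed.

(** The left side is (A C)^n; the factors C are collected on the left, each raising the powers of A
    it crosses to the power alpha. *)
Lemma AnJB n : (A ^+ n) ^ B = C ^+ n * A ^+ (al * r n).
Proof.
elim: n => [|n IH]; first by rewrite conj1g geo0 muln0 mulg1.
rewrite expgSr conjMg IH AJB -mulgA.
have -> : A ^+ (al * r n) * (A * C) = C * A ^+ (al * r n.+1).
  rewrite mulgA -expgSr conjgC -[C in _ ^ C]expg1 AnJCk geoS expn1.
  by congr (_ * _ ^+ _); rewrite mulnC add1n.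
by rewrite mulgA -expgSr.
Qed.
End Conjugation.

Lemma BnJCVk (gT : finGroupType) (A B : gT) n k : rel A B ->
  (B ^+ n) ^ ([~ A, B] ^- k) = B ^+ (n * al ^ k).
Proof.
by move=> rAB; rewrite -expgVn invg_comm (AnJCk (J_relations_sym rAB)).
Qed.

Lemma BnJA (gT : finGroupType) (A B : gT) n : rel A B ->
  (B ^+ n) ^ A = [~ A, B] ^- n * B ^+ (al * r n).
Proof.
by move=> rAB; rewrite -expgVn invg_comm (AnJB (J_relations_sym rAB)).
Qed.

Section Key_relation.
Variables (gT : finGroupType) (A B : gT).
Hypothesis relAB : rel A B.
Local Notation C := [~ A, B].

(* Conjugation by C maps A to A^alpha and B^alpha to B, so that
   [A^alpha, B] = [A, B^alpha]^C; both sides are then expanded. *)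
Lemma key_rel N : (al ^ al = r al + N)%N -> (B ^+ N) ^ (C ^+ al) = A ^- (al * N).
Proof.
move=> NE.
have BC : (B ^+ al) ^ C = B by rewrite -(BJCV relAB) -conjgM mulVg conjg1.
have E1 : [~ A ^+ al, B] = [~ A, B ^+ al] ^ C by rewrite conjRg (AJC relAB) BC.
have L : [~ A ^+ al, B] = A ^- al * C ^+ al * A ^+ (al * r al).
  by rewrite commgEl AnJB // mulgA.
have Rr : [~ A, B ^+ al] ^ C = B ^- r al * C ^+ al * B.
  rewrite commgEr conjVg BnJA // invMg invgK !conjMg conjVg expgM conjXg BC.
  by rewrite conjXg conjgE mulKg.
have AC : A ^- al * C ^+ al = C ^+ al * A ^- (al * al ^ al).
  by rewrite conjgC conjVg AnJCk.
have CB : C ^+ al * B = B ^+ (al ^ al) * C ^+ al.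
  have := BnJCVk 1 al relAB; rewrite expg1 mul1n => <-.
  by rewrite conjgE invgK !mulgA mulgKV.
move: E1; rewrite L Rr AC -mulgA -[RHS]mulgA CB NE.
rewrite [B ^+ (_ + _)]expgD -mulgA mulKg mulnDr addnC [A ^+ (_ + _)]expgD invMg mulgKV => E.
by rewrite conjgE -E mulKg.
Qed.
End Key_relation.

Lemma alpha_expn_alpha_inv :
  exists u, exists2 v, (al ^ al = r al + q ^ 2 * u)%N & (u * v = 1 %[mod q])%N.
Proof.
have [u E co] := alpha_expn_alpha pp p_odd m_gt0 ellp ell3; exists u.
have q1 := q_gt1 pp m_gt0.
have u0 : (0 < u)%N by case: (u) co => //; rewrite /coprime gcd0n; case: ltngtP q1.
case: (egcdnP q u0) => v w e _; exists v => //.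
by rewrite mulnC e (eqnP co) modnMDl.
Qed.

Lemma expg_eqmod (gT : finGroupType) (x : gT) n i j :
  x ^+ n = 1 -> i = j %[mod n] -> x ^+ i = x ^+ j.
Proof. by move=> xn e; rewrite -(expg_mod i xn) e expg_mod. Qed.

Lemma expg_dvd (gT : finGroupType) (x : gT) n i : x ^+ n = 1 -> (n %| i)%N -> x ^+ i = 1.
Proof. by move=> xn /dvdnP[k ->]; rewrite mulnC expgM xn expg1n. Qed.

Section Commuting.
Variables (gT : finGroupType) (A B : gT).
Hypothesis relAB : rel A B.
Local Notation C := [~ A, B].
Local Notation Z := (A ^+ (q ^ 2)).

Lemma Zq : Z ^+ q = 1.
Proof. by rewrite -expgM -expnSr (Aq3 relAB). Qed.

Let Bq2q : (B ^+ (q ^ 2)) ^+ q = 1.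
Proof. by rewrite -expgM -expnSr (Bq3 relAB). Qed.

(** By [key_rel] a conjugate of B^N by a power of C lies in <A>, and C normalizes <A>. So B^N lies
    in <A>, commutes with A and B, hence with C, and the conjugation in [key_rel] disappears.
    Finally alpha N = N modulo q^3. *)
Lemma A_Bq2_inv u : (al ^ al = r al + q ^ 2 * u)%N ->
  commute A (B ^+ (q ^ 2 * u)) /\ A ^+ (q ^ 2 * u) * B ^+ (q ^ 2 * u) = 1.
Proof.
move=> /(key_rel relAB); set N := (q ^ 2 * u)%N => E.
have nC : C \in 'N(<[A]>).
  by rewrite inE -cycleJ cycle_subG (AJC relAB) mem_cycle.
have BA : B ^+ N \in <[A]>.
  rewrite -(memJ_norm _ (groupX al nC)) E groupV mem_cycle //.
have cA : commute A (B ^+ N).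
  by apply/esym/cent1P; rewrite (subsetP _ _ BA) // cycle_subG cent1id.
have cC : C \in 'C[B ^+ N].
  by apply: groupR; apply/cent1P; [apply: cA | apply: commuteX].
have BJ : (B ^+ N) ^ (C ^+ al) = B ^+ N.
  by apply/conjg_fixP/commgP/commuteX/commute_sym/cent1P.
rewrite BJ in E; split=> //; rewrite E.
rewrite (_ : (_ * N = N + q ^ 3 * (ell * u))%N); last by rewrite /N; ring.
by rewrite expgD [A ^+ (q ^ 3 * _)]expgM (Aq3 relAB) expg1n mulg1 mulgV.
Qed.

Lemma commute_A_Bq2 : commute A (B ^+ (q ^ 2)).
Proof.
have [u [v /A_Bq2_inv[cA _] uv]] := alpha_expn_alpha_inv.
have -> : B ^+ (q ^ 2) = (B ^+ (q ^ 2 * u)) ^+ v.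
  by rewrite -expgM -mulnA expgM (expg_eqmod Bq2q uv).
exact: commuteX.
Qed.
End Commuting.

Section Powers.
Variables (gT : finGroupType) (A B : gT).
Hypothesis relAB : rel A B.
Let relBA := J_relations_sym relAB.
Local Notation C := [~ A, B].
Local Notation Z := (A ^+ (q ^ 2)).

Lemma Z_commB : commute Z B.
Proof. exact/commute_sym/(commute_A_Bq2 relBA). Qed.

Lemma Z_commA : commute Z A.
Proof. exact/commute_sym/commuteX. Qed.

Lemma Z_commC : commute Z C.
Proof.
suff /cent1P : C \in 'C[Z] by move/commute_sym.
by apply: groupR; apply/cent1P/commute_sym; [apply: Z_commA | apply: Z_commB].
Qed.

(** The u-th and q-th powers of A^(q^2) B^(q^2) are trivial, and u is invertible modulo q. *)
Lemma Bq2 : B ^+ (q ^ 2) = Z^-1.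
Proof.
have [u [v /(A_Bq2_inv relAB)[_ E] uv]] := alpha_expn_alpha_inv.
have cZ : commute Z (B ^+ (q ^ 2)) by apply: commuteX; apply: Z_commB.
apply: (mulgI Z); rewrite mulgV.
have K : (Z * B ^+ (q ^ 2)) ^+ q = 1.
  by rewrite expgMn // (Zq relAB) (Zq relBA) mulg1.
rewrite -[LHS]expg1 -(expg_eqmod K uv) expgM expgMn // -!expgM E expg1n //.
Qed.

(** B centralizes A^(q^2), while [AnJB] makes the conjugate of A^(q^2) by B equal to C^(q^2)
    A^(q^2). *)
Lemma Cq2 : C ^+ (q ^ 2) = 1.
Proof.
have [k E] := geo_q ell pp p_odd m_gt0 (or_intror erefl).
have := AnJB relAB (q ^ 2); rewrite E (_ : (al * _ = q ^ 2 + q ^ 3 * (k + ell * (1 + q * k)))%N); last by ring.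
rewrite expgD [A ^+ (q ^ 3 * _)]expgM (Aq3 relAB) expg1n mulg1.
rewrite conjgE Z_commB mulKg => /(congr1 (mulg^~ Z^-1)).
by rewrite mulgV mulgK.
Qed.

Lemma AqJB : exists k, (A ^+ q) ^ B = C ^+ q * A ^+ q * Z ^+ k.
Proof.
have [k E] := geo_q ell pp p_odd m_gt0 (or_introl erefl).
exists (ell + k + ell * q * k)%N.
by rewrite (AnJB relAB) E -mulgA -expgM -expgD; congr (_ * _ ^+ _); ring.
Qed.

Lemma AJCq : A ^ (C ^+ q) = A * Z ^+ ell.
Proof.
have [k E] := alpha_expn_q ell pp p_odd m_gt0.
rewrite -{1}[A]expg1 (AnJCk relAB) mul1n E !expgD expg1 [A ^+ (q ^ 3 * _)]expgM.
by rewrite (Aq3 relAB) expg1n mulg1 mulnC expgM.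
Qed.

Lemma AqJC : (A ^+ q) ^ C = A ^+ q * Z ^+ ell.
Proof.
rewrite conjXg (AJC relAB) -!expgM -expgD; congr (_ ^+ _); ring.
Qed.
End Powers.

Section Commutators_q.
Variables (gT : finGroupType) (A B : gT).
Hypothesis relAB : rel A B.
Let relBA := J_relations_sym relAB.
Local Notation C := [~ A, B].
Local Notation Z := (A ^+ (q ^ 2)).

Let CV : [~ B, A] = C^-1. Proof. by rewrite invg_comm. Qed.
Let ZV : B ^+ (q ^ 2) = Z^-1. Proof. exact: Bq2. Qed.

(** The exchange of generators inverts C and Z together, so the exponent l keeps the sign that it
    has for A. *)
Lemma BJCq : B ^ (C ^+ q) = B * Z ^+ ell.
Proof.
have := AJCq relBA; rewrite CV ZV !expgVn => /(congr1 (conjg^~ (C ^+ q))).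
rewrite -conjgM mulVg conjg1 conjMg conjVg.
have -> : (Z ^+ ell) ^ (C ^+ q) = Z ^+ ell.
  by apply/conjg_fixP/commgP/commuteX2/(Z_commC relAB).
by move=> {3}->; rewrite mulgKV.
Qed.

Lemma BqJC : (B ^+ q) ^ C = B ^+ q * Z ^+ ell.
Proof.
have := AqJC relBA; rewrite CV ZV !expgVn => /(congr1 (conjg^~ C)).
rewrite -conjgM mulVg conjg1 conjMg conjVg.
have -> : (Z ^+ ell) ^ C = Z ^+ ell.
  by apply/conjg_fixP/commgP/commute_sym/commuteX/commute_sym/(Z_commC relAB).
by move=> {2}->; rewrite mulgKV.
Qed.

Lemma comm_A_Cq : [~ A, C ^+ q] = Z ^+ ell.
Proof. by rewrite commgEl (AJCq relAB) mulKg. Qed.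
Lemma comm_B_Cq : [~ B, C ^+ q] = Z ^+ ell.
Proof. by rewrite commgEl BJCq mulKg. Qed.
Lemma comm_Aq_C : [~ A ^+ q, C] = Z ^+ ell.
Proof. by rewrite commgEl (AqJC relAB) mulKg. Qed.
Lemma comm_Bq_C : [~ B ^+ q, C] = Z ^+ ell.
Proof. by rewrite commgEl BqJC mulKg. Qed.

Lemma commute_Aq_Cq : commute (A ^+ q) (C ^+ q).
Proof.
apply/commgP/conjg_fixP; rewrite conjXg (AJCq relAB) expgMn; last first.
  by apply: commuteX; apply/commute_sym/Z_commA.
by rewrite -expgM mulnC expgM (Zq relAB) expg1n mulg1.
Qed.

Lemma comm_Aq_B : exists k, [~ A ^+ q, B] = C ^+ q * Z ^+ k.
Proof.
have [k E] := AqJB relAB; exists k.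
by rewrite commgEl E -commute_Aq_Cq -mulgA mulKg.
Qed.
End Commutators_q.

Section Commutators_swapped.
Variables (gT : finGroupType) (A B : gT).
Hypothesis relAB : rel A B.
Let relBA := J_relations_sym relAB.
Local Notation C := [~ A, B].
Local Notation Z := (A ^+ (q ^ 2)).

Let CV : [~ B, A] = C^-1. Proof. by rewrite invg_comm. Qed.
Let ZV : B ^+ (q ^ 2) = Z^-1. Proof. exact: Bq2. Qed.

Lemma comm_Bq_A : exists k, [~ B ^+ q, A] = C ^- q * Z ^- k.
Proof. by have [k E] := comm_Aq_B relBA; exists k; rewrite E CV ZV !expgVn. Qed.

Lemma commute_Bq_Cq : commute (B ^+ q) (C ^+ q).
Proof.
have := commute_Aq_Cq relBA; rewrite CV expgVn => /commuteV; by rewrite invgK.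
Qed.

(** Here A^(B^q) = A C^q Z^k. In its q-th power C^q and Z contribute 1, and [C^q, A] occurs with
    exponent binom(q, 2), a multiple of q. *)
Lemma commute_Aq_Bq : commute (A ^+ q) (B ^+ q).
Proof.
have [k E] := comm_Bq_A.
apply/commgP/conjg_fixP; rewrite conjXg.
have -> : A ^ (B ^+ q) = A * C ^+ q * Z ^+ k.
  rewrite -[LHS](mulKVg A) -commgEl -invg_comm E invMg !invgK -mulgA; congr (_ * _).
  by apply: commuteX2; apply: Z_commC.
rewrite (expgMn q (_ : commute (A * C ^+ q) (Z ^+ k))); last first.
  apply/commuteX/commute_sym/commuteM; first exact: Z_commA.
  exact/commuteX/(Z_commC relAB).
rewrite -[(Z ^+ k) ^+ q]expgM [(k * q)%N]mulnC expgM (Zq relAB) expg1n mulg1.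
have cE : [~ C ^+ q, A] = Z ^- ell by rewrite -invg_comm (comm_A_Cq relAB).
rewrite expMg_Rmul cE.
- rewrite -expgM mulnn (Cq2 relAB) mulg1 expgVn.
  rewrite (expg_dvd _ (dvdn_bin2 (odd_q m p_odd))) ?invg1 ?mulg1 //.
  by rewrite -expgM mulnC expgM (Zq relAB) expg1n.
- exact/commuteV/commuteX/commute_sym/commuteX/(Z_commC relAB).
- exact/commuteV/commuteX/commute_sym/Z_commA.
Qed.
End Commutators_swapped.
End Relations.

(** * Commutator conditions tested on two generators *)

Section Two_generators.
Variables (gT : finGroupType) (J : {group gT}) (A B : gT).
Hypothesis genJ : <<[set A; B]>> = J.

Lemma gen_memA : A \in J. Proof. by rewrite -genJ mem_gen // !inE eqxx. Qed.
Lemma gen_memB : B \in J. Proof. by rewrite -genJ mem_gen // !inE eqxx orbT. Qed.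

Lemma gen2_sub (G : {group gT}) : A \in G -> B \in G -> J \subset G.
Proof. by move=> GA GB; rewrite -genJ gen_subG; apply/subsetP => x /set2P[]->. Qed.

Lemma coset_commP (N : {group gT}) x y : x \in 'N(N) -> y \in 'N(N) ->
  reflect (commute (coset N x) (coset N y)) ([~ x, y] \in N).
Proof.
move=> nx ny; apply: (iffP idP) => [xyN | /commgP/eqP c].
  by apply/commgP; rewrite -morphR //= coset_id.
by apply: coset_idr; rewrite ?groupR // morphR.
Qed.

(** The condition says that g centralizes x modulo N, and such g form a group. *)
Lemma comm_gen (N : {group gT}) x : N <| J -> x \in J ->
  [~ x, A] \in N -> [~ x, B] \in N -> forall g, g \in J -> [~ x, g] \in N.
Proof.
case/andP=> _ nN Jx xA xB g Jg; have nx := subsetP nN.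
apply/coset_commP; rewrite ?nx //.
suff /subsetP/(_ g Jg)/morphpreP[_ /cent1P] : J \subset coset N @*^-1 'C[coset N x] by [].
by apply: gen2_sub; apply/morphpreP; split; rewrite ?nx ?gen_memA ?gen_memB //;
   apply/cent1P/commute_sym/coset_commP; rewrite ?nx ?gen_memA ?gen_memB.
Qed.

Lemma ucnS_gen n x :
  x \in 'Z_n.+1(J) = [&& x \in J, [~ x, A] \in 'Z_n(J) & [~ x, B] \in 'Z_n(J)].
Proof.
rewrite ucnSnR inE; case Jx: (x \in J) => //=.
apply/idP/andP => [/subsetP xJ | [xA xB]].
  by split; apply: xJ; rewrite mem_commg ?set11 ?gen_memA ?gen_memB.
rewrite gen_subG; apply/subsetP => _ /imset2P[y g /set1P-> Jg ->].
exact: (comm_gen (ucn_normal n J)).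
Qed.

Lemma ext_normal (N : {group gT}) x : N <| J -> x \in J ->
  [~ x, A] \in N -> [~ x, B] \in N -> N <*> <[x]> <| J.
Proof.
move=> /andP[sN nN] Jx xA xB; apply/andP; split.
  by rewrite join_subG sN cycle_subG.
have H g : g \in J -> [~ x, g] \in N -> g \in 'N(N <*> <[x]>).
  move=> Jg xg; rewrite inE conjYg (normP (subsetP nN g Jg)) -cycleJ join_subG.
  rewrite joing_subl cycle_subG -(mulKVg x (x ^ g)) -commgEl groupM //.
    by rewrite mem_gen // inE cycle_id orbT.
  by rewrite mem_gen // inE xg.
by apply: gen2_sub; apply: H; rewrite ?gen_memA ?gen_memB.
Qed.
End Two_generators.

Section Ext.
Variables (gT : finGroupType) (N : {group gT}) (x : gT) (n : nat).
Hypotheses (nx : x \in 'N(N)) (n0 : (0 < n)%N) (xn : x ^+ n \in N).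

Lemma ext_card : #|N <*> <[x]>| = (#|N| * #[coset N x])%N.
Proof.
have sN : N \subset N <*> <[x]> by rewrite joing_subl.
have nN : N <*> <[x]> \subset 'N(N) by rewrite join_subG normG cycle_subG.
rewrite -(Lagrange sN) -(card_quotient nN) /= quotientYidl ?cycle_subG //.
by rewrite quotient_cycle.
Qed.

Lemma ext_order_dvd : #[coset N x] %| n.
Proof. by rewrite order_dvdn -morphX //= coset_id. Qed.

Lemma ext_card_le : (#|N <*> <[x]>| <= #|N| * n)%N.
Proof. by rewrite ext_card leq_mul // dvdn_leq // ext_order_dvd. Qed.

Lemma ext_exact : #|N <*> <[x]>| = (#|N| * n)%N -> forall k, x ^+ k \in N -> n %| k.
Proof.
rewrite ext_card => /eqP; rewrite eqn_pmul2l // => /eqP <- k xk.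
by rewrite order_dvdn -morphX //= coset_id.
Qed.

Lemma ext_mem g : g \in N <*> <[x]> -> exists2 h, h \in N & exists k, g = h * x ^+ k.
Proof.
rewrite norm_joinEr ?cycle_subG // => /mulsgP[h _ Nh /cycleP[k ->] ->].
by exists h => //; exists k.
Qed.
End Ext.

(** * The central series *)

Section Chain.
Variables (p m ell : nat).
Hypotheses (pp : prime p) (p_odd : odd p) (m_gt0 : (0 < m)%N) (ellp : ~~ (p %| ell)).
Hypothesis ell3 : p = 3 -> m = 1%N -> ell = 1 %[mod 3].
Local Notation q := (p ^ m)%N.
Local Notation al := (1 + ell * q)%N.
Local Notation rel := (J_relations p m al).
Variables (gT : finGroupType) (J : {group gT}) (A B : gT).
Hypothesis genJ : <<[set A; B]>> = J.
Hypothesis relAB : rel A B.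
Local Notation C := [~ A, B].
Local Notation Z := (A ^+ (q ^ 2)).
Let relBA := J_relations_sym relAB.
Let JA := gen_memA genJ.
Let JB := gen_memB genJ.
Let JC : C \in J. Proof. by rewrite groupR. Qed.

(* When |J| = q^7, Z_1, Z_2, Z_3, Z_4 and Z_5 are chain1, chain2, chain4, chain5
   and chain7. *)
Definition chain1 := <[Z]>%G.
Definition chain2 := (chain1 <*> <[C ^+ q]>)%G.
Definition chain3 := (chain2 <*> <[A ^+ q]>)%G.
Definition chain4 := (chain3 <*> <[B ^+ q]>)%G.
Definition chain5 := (chain4 <*> <[C]>)%G.
Definition chain6 := (chain5 <*> <[A]>)%G.
Definition chain7 := (chain6 <*> <[B]>)%G.

Lemma Z_chain1 k : Z ^+ k \in chain1. Proof. exact: mem_cycle. Qed.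
Lemma chain1_sub2 : chain1 \subset chain2. Proof. exact: joing_subl. Qed.
Lemma chain2_sub3 : chain2 \subset chain3. Proof. exact: joing_subl. Qed.
Lemma chain3_sub4 : chain3 \subset chain4. Proof. exact: joing_subl. Qed.
Lemma chain4_sub5 : chain4 \subset chain5. Proof. exact: joing_subl. Qed.
Lemma chain5_sub6 : chain5 \subset chain6. Proof. exact: joing_subl. Qed.
Lemma Cq_chain2 : C ^+ q \in chain2. Proof. by rewrite mem_gen // inE cycle_id orbT. Qed.
Lemma Aq_chain3 : A ^+ q \in chain3. Proof. by rewrite mem_gen // inE cycle_id orbT. Qed.
Lemma Bq_chain4 : B ^+ q \in chain4. Proof. by rewrite mem_gen // inE cycle_id orbT. Qed.
Lemma C_chain5 : C \in chain5. Proof. by rewrite mem_gen // inE cycle_id orbT. Qed.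
Lemma A_chain6 : A \in chain6. Proof. by rewrite mem_gen // inE cycle_id orbT. Qed.
Lemma chain2_sub4 : chain2 \subset chain4. Proof. exact: subset_trans chain2_sub3 chain3_sub4. Qed.

Lemma comm_chain1 x : x \in chain1 -> forall g, g \in J -> [~ x, g] = 1.
Proof.
move=> /cycleP[k ->] g Jg.
have [cA cB] := (Z_commA p m A, Z_commB pp p_odd m_gt0 ellp ell3 relAB).
apply/eqP/commgP/commute_sym/commuteX/commute_sym.
have /subsetP/(_ g Jg)/cent1P : J \subset 'C[Z]; last exact/commute_sym.
by apply: (gen2_sub genJ); apply/cent1P/commute_sym.
Qed.

Let cACq := comm_A_Cq pp p_odd m_gt0 relAB.
Let cBCq := comm_B_Cq pp p_odd m_gt0 ellp ell3 relAB.

Lemma comm_Cq_gen x : x \in [set A; B] -> [~ C ^+ q, x] \in chain1.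
Proof.
by case/set2P=> ->; rewrite -groupV invg_comm (cACq, cBCq) Z_chain1.
Qed.

Lemma chain1_normal : chain1 <| J.
Proof.
apply/andP; split; first by rewrite cycle_subG groupX.
apply/subsetP => g Jg; rewrite inE -cycleJ cycle_subG.
by rewrite -(mulKVg Z (Z ^ g)) -commgEl comm_chain1 ?cycle_id // mulg1 cycle_id.
Qed.

Lemma chain2_normal : chain2 <| J.
Proof. by apply: (ext_normal genJ chain1_normal); rewrite ?groupX // comm_Cq_gen // !inE eqxx ?orbT. Qed.

Lemma Aq_A : [~ A ^+ q, A] = 1.
Proof. exact/eqP/commgP/commute_sym/commuteX. Qed.
Lemma Bq_B : [~ B ^+ q, B] = 1.
Proof. exact/eqP/commgP/commute_sym/commuteX. Qed.
Lemma Aq_B : exists2 z, z \in chain1 & [~ A ^+ q, B] = C ^+ q * z.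
Proof.
have [k ->] := comm_Aq_B pp p_odd m_gt0 relAB.
by exists (Z ^+ k); rewrite ?Z_chain1.
Qed.
Lemma Bq_A : exists2 z, z \in chain1 & [~ B ^+ q, A] = C ^- q * z.
Proof.
have [k ->] := comm_Bq_A pp p_odd m_gt0 ellp ell3 relAB.
by exists (Z ^- k); rewrite ?groupV ?Z_chain1.
Qed.
Lemma Aq_B_chain2 : [~ A ^+ q, B] \in chain2.
Proof. by have [z /(subsetP chain1_sub2) ? ->] := Aq_B; rewrite groupM ?Cq_chain2. Qed.
Lemma Bq_A_chain2 : [~ B ^+ q, A] \in chain2.
Proof. by have [z /(subsetP chain1_sub2) ? ->] := Bq_A; rewrite groupM ?groupV ?Cq_chain2. Qed.

Lemma chain3_normal : chain3 <| J.
Proof. by apply: (ext_normal genJ chain2_normal); rewrite ?groupX // ?Aq_A ?group1 ?Aq_B_chain2. Qed.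
Lemma chain4_normal : chain4 <| J.
Proof.
apply: (ext_normal genJ chain3_normal); rewrite ?groupX // ?Bq_B ?group1 //.
by apply: (subsetP chain2_sub3); apply: Bq_A_chain2.
Qed.

Lemma comm_A_C : [~ A, C] = (A ^+ q) ^+ ell.
Proof. by rewrite commgEl (AJC relAB) expgD expg1 mulKg mulnC expgM. Qed.
Lemma comm_B_CV : [~ B, C^-1] = (B ^+ q) ^+ ell.
Proof. by rewrite commgEl (BJCV relAB) expgD expg1 mulKg mulnC expgM. Qed.
Lemma comm_C_A : [~ C, A] \in chain3.
Proof. by rewrite -groupV invg_comm comm_A_C groupX ?Aq_chain3. Qed.
Lemma comm_C_B : [~ C, B] \in chain4.
Proof.
have [nC nB] : C \in 'N(chain4) /\ B \in 'N(chain4) by rewrite !(subsetP (normal_norm chain4_normal)).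
have /coset_commP : [~ B, C^-1] \in chain4 by rewrite comm_B_CV groupX ?Bq_chain4.
rewrite groupV morphV // => /(_ nB nC)/commuteV; rewrite invgK => c.
exact/coset_commP/commute_sym.
Qed.

Lemma chain5_normal : chain5 <| J.
Proof.
apply: (ext_normal genJ chain4_normal); rewrite ?groupX // ?comm_C_B //.
by apply: (subsetP chain3_sub4); apply: comm_C_A.
Qed.
Lemma chain6_normal : chain6 <| J.
Proof. by apply: (ext_normal genJ chain5_normal); rewrite // ?commgg ?group1 // C_chain5. Qed.
Lemma chain7E : chain7 :=: J.
Proof.
apply/eqP; rewrite eqEsubset join_subG cycle_subG JB (normal_sub chain6_normal).
rewrite (gen2_sub genJ) // mem_gen // inE ?cycle_id ?orbT // A_chain6 //.
Qed.

Let nn (N : {group gT}) x : N <| J -> x \in J -> x \in 'N(N).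
Proof. by move=> /andP[_ /subsetP]; apply. Qed.
Let q0 : (0 < q)%N. Proof. by rewrite expn_gt0 prime_gt0. Qed.

Hypothesis cardJ_ge : (q ^ 7 <= #|J|)%N.

(** Seven steps, each multiplying the order by at most q, reach at least q^7, so every step is
    exact. [up] carries upper bounds from the bottom of the chain, [dn] lower bounds from the
    top. *)
Lemma card_chain : [/\ #|chain1| = q, #|chain2| = (q ^ 2)%N, #|chain3| = (q ^ 3)%N, #|chain4| = (q ^ 4)%N &
  [/\ #|chain5| = (q ^ 5)%N, #|chain6| = (q ^ 6)%N & #|J| = (q ^ 7)%N]].
Proof.
have l1 : (#|chain1| <= q)%N.
  by rewrite dvdn_leq // [#|_|]/#[Z] order_dvdn -expgM -expnSr (Aq3 relAB).
have Zq : A ^+ q ^+ q = Z by rewrite -expgM mulnn.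
have S (N : {group gT}) x : N <| J -> x \in J -> x ^+ q \in N -> (#|N <*> <[x]>| <= #|N| * q)%N.
  by move=> nN Jx xq; apply: ext_card_le; rewrite ?nn.
have l2 : (#|chain2| <= #|chain1| * q)%N.
  by apply: S; [exact: chain1_normal | exact: groupX |]; rewrite -expgM mulnn (Cq2 pp p_odd m_gt0 ellp ell3 relAB).
have l3 : (#|chain3| <= #|chain2| * q)%N.
  by apply: S; [exact: chain2_normal | exact: groupX |]; rewrite Zq (subsetP chain1_sub2) ?cycle_id.
have l4 : (#|chain4| <= #|chain3| * q)%N.
  apply: S; [exact: chain3_normal | exact: groupX |]; rewrite -expgM mulnn (Bq2 pp p_odd m_gt0 ellp ell3 relAB).
  by rewrite groupV (subsetP (subset_trans chain1_sub2 chain2_sub3)) ?cycle_id.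
have l5 : (#|chain5| <= #|chain4| * q)%N.
  by apply: S; rewrite ?chain4_normal // (subsetP chain2_sub4) ?Cq_chain2.
have l6 : (#|chain6| <= #|chain5| * q)%N.
  by apply: S; rewrite ?chain5_normal // (subsetP (subset_trans chain3_sub4 chain4_sub5)) ?Aq_chain3.
have l7 : (#|chain7| <= #|chain6| * q)%N.
  by apply: S; rewrite ?chain6_normal // (subsetP (subset_trans chain4_sub5 chain5_sub6)) ?Bq_chain4.
have up k a b : (a <= q ^ k -> b <= a * q -> b <= q ^ k.+1)%N.
  by move=> ak /leq_trans->//; rewrite expnSr leq_mul2r ak orbT.
have dn k a b : (q ^ k.+1 <= b -> b <= a * q -> q ^ k <= a)%N.
  by move=> kb ba; rewrite -(leq_pmul2r q0) -expnSr (leq_trans kb).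
move: cardJ_ge; rewrite -chain7E => g7.
have g6 := dn 6 _ _ g7 l7; have g5 := dn 5 _ _ g6 l6; have g4 := dn 4 _ _ g5 l5.
have g3 := dn 3 _ _ g4 l4; have g2 := dn 2 _ _ g3 l3; have g1 := dn 1%N _ _ g2 l2.
have u2 := up 1%N _ _ l1 l2; have u3 := up _ _ _ u2 l3; have u4 := up _ _ _ u3 l4.
have u5 := up _ _ _ u4 l5; have u6 := up _ _ _ u5 l6; have u7 := up _ _ _ u6 l7.
by do ?split; apply/eqP; rewrite eqn_leq; apply/andP.
Qed.

Lemma exact_Z k : Z ^+ k = 1 -> q %| k.
Proof.
have [c1 _ _ _ _] := card_chain.
by move/eqP; rewrite -order_dvdn /order c1.
Qed.

Let ex (N : {group gT}) x : x ^+ q \in N -> N <| J -> x \in J ->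
  #|N <*> <[x]>| = (#|N| * q)%N -> forall k, x ^+ k \in N -> q %| k.
Proof. by move=> xq nN Jx; apply: ext_exact; rewrite ?nn. Qed.

Lemma exact_Cq k : C ^+ q ^+ k \in chain1 -> q %| k.
Proof.
have [c1 c2 _ _ _] := card_chain; apply: ex; [|exact: chain1_normal|exact: groupX|].
  by rewrite -expgM mulnn (Cq2 pp p_odd m_gt0 ellp ell3 relAB).
by rewrite -/chain2 c2 c1 mulnn.
Qed.

Lemma exact_Aq k : A ^+ q ^+ k \in chain2 -> q %| k.
Proof.
have [c1 c2 c3 _ _] := card_chain; apply: ex; [|exact: chain2_normal|exact: groupX|].
  by rewrite -expgM mulnn (subsetP chain1_sub2) ?cycle_id.
by rewrite -/chain3 c3 c2 -expnSr.
Qed.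

Lemma exact_C k : C ^+ k \in chain4 -> q %| k.
Proof.
have [_ _ _ c4 [c5 _ _]] := card_chain; apply: ex; rewrite ?chain4_normal //.
  by rewrite (subsetP chain2_sub4) ?Cq_chain2.
by rewrite -/chain5 c5 c4 -expnSr.
Qed.
End Chain.

Ltac in_group := by repeat first [done | apply: groupM | apply: groupR | apply: groupX | rewrite groupV].

Section Commutators.
Variables (gT : finGroupType) (J N : {group gT}).
Hypothesis nN : N <| J.

(** Modulo N, n drops out and [X^i, Y] = [X, Y]^i. This turns centrality of an element in normal
    form into divisibility of its exponents. *)
Lemma comm_pow n X Y i : n \in J -> X \in J -> Y \in J -> [~ n, Y] \in N ->
  [~ [~ X, Y], X] \in N -> [~ n * X ^+ i, Y] \in N -> [~ X, Y] ^+ i \in N.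
Proof.
move=> Jn JX JY nY cX; have nJ := subsetP (normal_norm nN).
have nXi : X ^+ i \in 'N(N) by rewrite nJ ?groupX.
rewrite commMgJ groupMl ?memJ_norm // => XiY.
have nXY : [~ X, Y] \in 'N(N) by rewrite nJ ?groupR.
apply: coset_idr; [exact: groupX|].
have c : commute (coset N X) [~ coset N X, coset N Y].
  rewrite -morphR ?nJ //=; apply/commute_sym/coset_commP => //; exact: nJ.
rewrite morphX // morphR ?nJ //= -commXg //.
by rewrite -morphX ?nJ // -morphR ?nJ ?groupX //= coset_id.
Qed.
Lemma comm_mulX n X i : X \in J -> [~ n, X] \in N -> [~ n * X ^+ i, X] \in N.
Proof.
move=> JX nX; have nJ := subsetP (normal_norm nN).
have /commgP/eqP E : commute (X ^+ i) X by apply/commute_sym/commuteX.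
by rewrite commMgJ E mulg1 memJ_norm // groupX // nJ.
Qed.

Lemma comm_mulXr n X Y : X \in J -> [~ X, Y] \in N -> [~ n * X, Y] \in N -> [~ n, Y] \in N.
Proof.
move=> JX XY; have nJ := subsetP (normal_norm nN).
by rewrite commMgJ groupMr // memJ_norm // nJ.
Qed.
End Commutators.

(** * Identification of the upper central series *)

Section Upper.
Variables (p m ell : nat).
Hypotheses (pp : prime p) (p_odd : odd p) (m_gt0 : (0 < m)%N) (ellp : ~~ (p %| ell)).
Hypothesis ell3 : p = 3 -> m = 1%N -> ell = 1 %[mod 3].
Local Notation q := (p ^ m)%N.
Local Notation al := (1 + ell * q)%N.
Local Notation rel := (J_relations p m al).
Variables (gT : finGroupType) (J : {group gT}) (A B : gT).
Hypothesis genJ : <<[set A; B]>> = J.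
Hypothesis relAB : rel A B.
Hypothesis cardJ_ge : (q ^ 7 <= #|J|)%N.
Local Notation C := [~ A, B].
Local Notation Z := (A ^+ (q ^ 2)).
Let JA := gen_memA genJ.
Let JB := gen_memB genJ.
Let JC : C \in J. Proof. by rewrite groupR. Qed.
Local Notation G1 := (chain1 p m A).
Local Notation G2 := (chain2 p m A B).
Local Notation G3 := (chain3 p m A B).
Local Notation G4 := (chain4 p m A B).
Local Notation G5 := (chain5 p m A B).
Let G1n : G1 <| J := chain1_normal pp p_odd m_gt0 ellp ell3 genJ relAB.
Let G2n : G2 <| J := chain2_normal pp p_odd m_gt0 ellp ell3 genJ relAB.
Let G3n : G3 <| J := chain3_normal pp p_odd m_gt0 ellp ell3 genJ relAB.
Let G4n : G4 <| J := chain4_normal pp p_odd m_gt0 ellp ell3 genJ relAB.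
Let G5n : G5 <| J := chain5_normal pp p_odd m_gt0 ellp ell3 genJ relAB.
Let G7E := chain7E pp p_odd m_gt0 ellp ell3 genJ relAB.
Let nJ (N : {group gT}) x : N <| J -> x \in J -> x \in 'N(N).
Proof. by move=> /andP[_ /subsetP]; apply. Qed.
Let G12 := subsetP (chain1_sub2 p m A B).
Let G23 := subsetP (chain2_sub3 p m A B).
Let G34 := subsetP (chain3_sub4 p m A B).
Let G24 := subsetP (chain2_sub4 p m A B).
Let G45 := subsetP (chain4_sub5 p m A B).

Lemma dvd_mem (N : {group gT}) x k : x ^+ q \in N -> q %| k -> x ^+ k \in N.
Proof. by move=> xq /dvdnP[i ->]; rewrite mulnC expgM groupX. Qed.

Lemma mem_chain2 g : g \in G2 -> exists2 z, z \in G1 & exists k, g = z * C ^+ q ^+ k.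
Proof. by apply: ext_mem; rewrite nJ ?groupX. Qed.
Lemma mem_chain4 g : g \in G4 ->
  exists2 z, z \in G2 & exists i j, g = z * A ^+ q ^+ i * B ^+ q ^+ j.
Proof.
case/ext_mem; rewrite ?nJ ?groupX // => h /ext_mem[|z Gz [i ->] [j ->]].
  by rewrite nJ ?groupX.
by exists z => //; exists i, j.
Qed.
Lemma mem_chain5 g : g \in G5 -> exists2 z, z \in G4 & exists k, g = z * C ^+ k.
Proof. by apply: ext_mem; rewrite nJ. Qed.
Lemma mem_gen_J g : g \in J -> exists2 z, z \in G5 & exists i j, g = z * A ^+ i * B ^+ j.
Proof.
rewrite -G7E => /(ext_mem (nJ (chain6_normal pp p_odd m_gt0 ellp ell3 genJ relAB) JB))[h].
case/(ext_mem (nJ G5n JA)) => z Gz [i ->] [j ->].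
by exists z => //; exists i, j.
Qed.

Let sJ (N : {group gT}) x : N <| J -> x \in N -> x \in J.
Proof. by move=> /normal_sub/subsetP; apply. Qed.

Lemma comm_ext (N : {group gT}) x h g : N <| J -> x \in J -> [~ x, A] \in N -> [~ x, B] \in N ->
  h \in N <*> <[x]> -> g \in J -> [~ h, g] \in N.
Proof.
move=> nN Jx xA xB + Jg; case/(ext_mem (nJ nN Jx)) => n Nn [k ->].
have Jh : n * x ^+ k \in J := groupM (sJ nN Nn) (groupX k Jx).
apply/coset_commP; rewrite ?nJ //.
have nx := nJ nN Jx; have nn := nJ nN (sJ nN Nn).
rewrite morphM ?groupX // morphX //= coset_id // mul1g.
apply/commute_sym/commuteX/commute_sym/coset_commP; rewrite ?nJ //.
exact: (comm_gen genJ).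
Qed.

Lemma comm_chain5 h g : h \in G5 -> g \in J -> [~ h, g] \in G4.
Proof.
apply: comm_ext => //; last exact: (comm_C_B pp p_odd m_gt0 ellp ell3 genJ relAB).
exact/G34/(comm_C_A relAB).
Qed.
Lemma comm_chain2 h g : h \in G2 -> g \in J -> [~ h, g] \in G1.
Proof.
apply: comm_ext; rewrite ?groupX //;
  apply: (comm_Cq_gen pp p_odd m_gt0 ellp ell3 relAB); by rewrite !inE eqxx ?orbT.
Qed.
Let cG1 h g : h \in G1 -> g \in J -> [~ h, g] = 1.
Proof. by move=> Gh; apply: (comm_chain1 pp p_odd m_gt0 ellp ell3 genJ relAB). Qed.
Lemma comm_chain3 h g : h \in G3 -> g \in J -> [~ h, g] \in G2.
Proof.
apply: comm_ext; rewrite ?groupX // ?(Aq_A p m A) ?group1 //.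
exact: (Aq_B_chain2 pp p_odd m_gt0 relAB).
Qed.
Lemma comm_chain4 h g : h \in G4 -> g \in J -> [~ h, g] \in G2.
Proof.
move=> /mem_chain4[z Gz [i [j ->]]] Jg.
have Bq_g : [~ B ^+ q, g] \in G2.
  apply: (comm_gen genJ) => //; rewrite ?groupX //.
    exact: (Bq_A_chain2 pp p_odd m_gt0 ellp ell3 relAB).
  by rewrite (Bq_B p m B) group1.
have z3 : z * A ^+ q ^+ i \in G3 by apply: groupM; [exact: G23 | apply/groupX/Aq_chain3].
have Jz := sJ G3n z3.
have JBq : B ^+ q \in J by in_group.
have nB : B ^+ q \in 'N(G2) by apply: nJ.
rewrite commMgJ; apply: groupM.
  by rewrite memJ_norm; [apply: comm_chain3 | apply: groupX].
apply/coset_commP; [exact: groupX | exact: nJ |]; rewrite morphX //.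
by apply/commute_sym/commuteX/commute_sym/coset_commP; [| apply: nJ |].
Qed.

Let CVE : [~ B, A] = C^-1. Proof. by rewrite invg_comm. Qed.

Let exC := exact_C pp p_odd m_gt0 ellp ell3 genJ relAB cardJ_ge.
Let exCq := exact_Cq pp p_odd m_gt0 ellp ell3 genJ relAB cardJ_ge.

(** Modulo G4, z A^i B^j has commutators C^(-j) with A and C^i with B, and C has order q there.
    Chained with the three descents that follow, this computes Z_1, ..., Z_4. *)
Lemma centre_mod_chain4 g : g \in J -> [~ g, A] \in G4 -> [~ g, B] \in G4 -> g \in G5.
Proof.
move=> /mem_gen_J[z Gz [i [j ->]]] gA gB.
have Jz := sJ G5n Gz.
have qj : q %| j.
  apply: exC; rewrite -groupV -expgVn -CVE.
  apply: (comm_pow G4n _ _ _ _ _ gA); rewrite // ?CVE; first by in_group.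
    by apply: (comm_mulX G4n) => //; apply: comm_chain5.
  by apply: comm_chain5; rewrite ?groupV ?C_chain5.
have GB : B ^+ j \in G4 by apply: dvd_mem => //; apply: Bq_chain4.
have qi : q %| i.
  apply: exC; apply: (comm_pow G4n Jz) => //; try by apply: comm_chain5; rewrite ?C_chain5.
  apply: (comm_mulXr G4n _ _ gB); first by in_group.
  by apply: G24; apply: comm_chain4.
apply: groupM; last exact: G45.
by apply: groupM => //; apply/G45/G34; apply: dvd_mem => //; apply: Aq_chain3.
Qed.

(** Modulo G2, the commutator of z C^k with A is A^(- q l k); A^q has order q there and l is prime
    to p. *)
Lemma centre_mod_chain2 g : g \in G5 -> [~ g, A] \in G2 -> g \in G4.
Proof.
move=> /mem_chain5[z Gz [k ->]] gA; have Jz := sJ G4n Gz.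
have : [~ C, A] ^+ k \in G2.
  apply: (comm_pow G2n Jz _ _ _ _ gA) => //; first by apply: comm_chain4.
  by apply: comm_chain3 => //; apply: (comm_C_A relAB).
rewrite -invg_comm expgVn groupV (comm_A_C relAB) -expgM.
move/(exact_Aq pp p_odd m_gt0 ellp ell3 genJ relAB cardJ_ge).
rewrite Gauss_dvdr; last by rewrite coprimeXl // prime_coprime.
by move=> qk; apply: groupM => //; apply: G24; apply: dvd_mem => //; apply: Cq_chain2.
Qed.

(** Modulo G1, the commutators of z A^(q i) B^(q j) with A and B are C^(- q j) and C^(q i). *)
Lemma centre_mod_chain1 g : g \in G4 -> [~ g, A] \in G1 -> [~ g, B] \in G1 -> g \in G2.
Proof.
move=> /mem_chain4[z Gz [i [j ->]]] gA gB; have Jz := sJ G2n Gz.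
have [z1 Gz1 E1] := Aq_B pp p_odd m_gt0 relAB.
have [z2 Gz2 E2] := Bq_A pp p_odd m_gt0 ellp ell3 relAB.
have qj : q %| j.
  apply: exCq.
  have : [~ B ^+ q, A] ^+ j \in G1.
    apply: (comm_pow G1n _ _ _ _ _ gA) => //; try by in_group.
      rewrite -expgM; apply: (comm_mulX G1n) => //; exact: comm_chain2.
    apply: comm_chain2; last by in_group.
    exact: (Bq_A_chain2 pp p_odd m_gt0 ellp ell3 relAB).
  have cz : commute (C ^- q) z2.
    by apply/commute_sym/commgP; rewrite cG1 //; in_group.
  by rewrite E2 expgMn // (groupMr _ (groupX j Gz2)) expgVn groupV.
have GB : B ^+ q ^+ j \in G1.
  apply: dvd_mem => //; rewrite -expgM mulnn (Bq2 pp p_odd m_gt0 ellp ell3 relAB).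
  by rewrite groupV cycle_id.
have qi : q %| i.
  apply: exCq.
  have : [~ A ^+ q, B] ^+ i \in G1.
    apply: (comm_pow G1n Jz) => //; try by in_group.
    - exact: comm_chain2.
    - apply: comm_chain2; last by in_group.
      exact: (Aq_B_chain2 pp p_odd m_gt0 relAB).
    by apply: (comm_mulXr G1n _ _ gB); [in_group | rewrite cG1].
  have cz : commute (C ^+ q) z1.
    by apply/commute_sym/commgP; rewrite cG1 //; in_group.
  by rewrite E1 expgMn // (groupMr _ (groupX i Gz1)).
apply: groupM; last exact: G12.
apply: groupM => //; apply: G12; apply: dvd_mem => //.
by rewrite -expgM mulnn cycle_id.
Qed.

Lemma centre_mod_1 g : g \in G2 -> [~ g, A] = 1 -> g \in G1.
Proof.
move=> /mem_chain2[z Gz [k ->]] gA; have Jz := sJ G1n Gz.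
have cE : [~ C ^+ q, A] = Z ^- ell by rewrite -invg_comm (comm_A_Cq pp p_odd m_gt0 relAB).
have c1 : commute (C ^+ q) [~ C ^+ q, A].
  by rewrite cE; apply/commute_sym/commgP; rewrite cG1 ?groupV ?Z_chain1 //; in_group.
have qk : q %| k.
  have : Z ^+ (ell * k) = 1.
    apply: (can_inj invgK); rewrite invg1 -gA commMgJ cG1 // conj1g mul1g.
    by rewrite commXg // cE expgM expgVn.
  move/(exact_Z pp p_odd m_gt0 ellp ell3 genJ relAB cardJ_ge).
  by rewrite Gauss_dvdr // coprimeXl // prime_coprime.
apply: groupM => //; apply: dvd_mem => //.
by rewrite -expgM mulnn (Cq2 pp p_odd m_gt0 ellp ell3 relAB) group1.
Qed.

Lemma ucn1E : 'Z_1(J) = G1.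
Proof.
apply/setP => x; rewrite (ucnS_gen genJ) ucn0 !inE.
apply/and3P/idP => [[Jx /eqP xA /eqP xB] | Gx].
  apply: centre_mod_1 => //; apply: centre_mod_chain1; rewrite ?xA ?xB //.
  apply: centre_mod_chain2; rewrite ?xA ?group1 //.
  by apply: centre_mod_chain4; rewrite ?xA ?xB ?group1.
by rewrite !cG1 // (sJ G1n).
Qed.

Lemma ucn2E : 'Z_2(J) = G2.
Proof.
apply/setP => x; rewrite (ucnS_gen genJ) ucn1E.
apply/and3P/idP => [[Jx xA xB] | Gx].
  apply: centre_mod_chain1 => //; apply: centre_mod_chain2; last exact: G12.
  by apply: centre_mod_chain4 => //; apply/G24/G12.
by rewrite !comm_chain2 // (sJ G2n).
Qed.

Lemma ucn3E : 'Z_3(J) = G4.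
Proof.
apply/setP => x; rewrite (ucnS_gen genJ) ucn2E.
apply/and3P/idP => [[Jx xA xB] | Gx].
  by apply: centre_mod_chain2 => //; apply: centre_mod_chain4 => //; apply: G24.
by rewrite !comm_chain4 // (sJ G4n).
Qed.

Lemma ucn4E : 'Z_4(J) = G5.
Proof.
apply/setP => x; rewrite (ucnS_gen genJ) ucn3E.
apply/and3P/idP => [[Jx xA xB] | Gx]; first exact: centre_mod_chain4.
by rewrite !comm_chain5 // (sJ G5n).
Qed.

End Upper.

(** Collection formula with t = [u, x] and z = [t, x], the process stopping at z. *)
Lemma expMg_comm3 (gT : finGroupType) (x u t z : gT) n :
    u ^ x = u * t -> t ^ x = t * z -> z ^ x = z ->
    commute u t -> commute u z -> commute t z ->
  (x * u) ^+ n = x ^+ n * (u ^+ n * t ^+ 'C(n, 2) * z ^+ 'C(n, 3)).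
Proof.
move=> ux tx zx ut uz tz; elim: n => [|n IH]; first by rewrite !bin0n !mulg1.
have E W : x ^+ n * W * (x * u) = x ^+ n.+1 * (W ^ x * u).
  by rewrite -mulgA (mulgA W) [W * x]conjgC expgSr !mulgA.
rewrite expgSr IH E; congr (_ * _); rewrite !conjMg !conjXg ux tx zx !expgMn //.
set R := t ^+ n * (t ^+ 'C(n, 2) * z ^+ 'C(n, 2)) * z ^+ 'C(n, 3).
have cR : commute u R by do !apply: commuteM; apply: commuteX.
have RE : R = t ^+ 'C(n.+1, 2) * z ^+ 'C(n.+1, 3).
  rewrite /R !binS bin1 addnC [('C(n, 3) + _)%N]addnC !expgD !mulgA //.
rewrite expgSr -[RHS]mulgA -RE -[RHS]mulgA cR /R; rewrite !mulgA //.
Qed.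

(** * Perturbing the generators by elements of Z_3 *)

Section Perturb.
Variables (p m ell : nat).
Hypotheses (pp : prime p) (p_odd : odd p) (m_gt0 : (0 < m)%N) (ellp : ~~ (p %| ell)).
Hypothesis ell3 : p = 3 -> m = 1%N -> ell = 1 %[mod 3].
Local Notation q := (p ^ m)%N.
Local Notation al := (1 + ell * q)%N.
Local Notation c3 := 'C(1 + ell * p ^ m, 3).
Local Notation rel := (J_relations p m al).
Variables (gT : finGroupType) (J : {group gT}) (A B : gT).
Hypothesis genJ : <<[set A; B]>> = J.
Hypothesis relAB : rel A B.
Hypothesis cardJ_ge : (q ^ 7 <= #|J|)%N.
Local Notation C := [~ A, B].
Local Notation Z := (A ^+ (q ^ 2)).
Let JA := gen_memA genJ.
Let JB := gen_memB genJ.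
Let JC : C \in J. Proof. by rewrite groupR. Qed.
Local Notation G1 := (chain1 p m A).
Local Notation G2 := (chain2 p m A B).
Local Notation G3 := (chain3 p m A B).
Local Notation G4 := (chain4 p m A B).
Let G1n : G1 <| J := chain1_normal pp p_odd m_gt0 ellp ell3 genJ relAB.
Let G2n : G2 <| J := chain2_normal pp p_odd m_gt0 ellp ell3 genJ relAB.
Let G4n : G4 <| J := chain4_normal pp p_odd m_gt0 ellp ell3 genJ relAB.
Let sJ (N : {group gT}) x : N <| J -> x \in N -> x \in J.
Proof. by move=> /normal_sub/subsetP; apply. Qed.
Let cG1 h g : h \in G1 -> g \in J -> commute h g.
Proof.
by move=> Gh Jg; apply/commgP; rewrite (comm_chain1 pp p_odd m_gt0 ellp ell3 genJ relAB).
Qed.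
Let G12 := subsetP (chain1_sub2 p m A B).
Let G23 := subsetP (chain2_sub3 p m A B).
Let G34 := subsetP (chain3_sub4 p m A B).
Let G24 := subsetP (chain2_sub4 p m A B).

Lemma chain4_abelian : abelian G4.
Proof.
have E (N : {group gT}) x : abelian N -> N \subset 'C[x] -> abelian (N <*> <[x]>).
  by move=> aN cN; rewrite abelianY aN cycle_abelian centsC cent_cycle.
have Y (N : {group gT}) x y : N \subset 'C[y] -> commute x y -> N <*> <[x]> \subset 'C[y].
  by move=> cN c; rewrite join_subG cN cycle_subG; apply/cent1P.
have c1 x : x \in J -> G1 \subset 'C[x].
  by move=> Jx; apply/subsetP => g Gg; apply/cent1P/cG1.
have cAC := commute_Aq_Cq pp p_odd m_gt0 relAB.
have cBC := commute_Bq_Cq pp p_odd m_gt0 relAB.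
have cAB := commute_Aq_Bq pp p_odd m_gt0 ellp ell3 relAB.
have a2 : abelian G2 by apply: (E); [apply: cycle_abelian | apply/c1/groupX].
have a3 : abelian G3.
  by apply: (E) => //; apply: (Y); [apply/c1/groupX | apply: commute_sym].
apply: (E) => //; apply: (Y) => //; apply: (Y); [apply/c1/groupX => // | exact: commute_sym].
Qed.

Let c4 x y : x \in G4 -> y \in G4 -> commute x y.
Proof. by move=> Gx Gy; apply: (centsP chain4_abelian). Qed.

Lemma Zq1 : Z ^+ q = 1. Proof. exact: Zq relAB. Qed.
Lemma order_Z : #[Z] = q.
Proof. by have [] := card_chain pp p_odd m_gt0 ellp ell3 genJ relAB cardJ_ge. Qed.

Lemma chain1_expg z : z \in G1 -> z ^+ q = 1.
Proof. by case/cycleP => k ->; rewrite -expgM mulnC expgM Zq1 expg1n. Qed.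

Lemma chain2_expg g : g \in G2 -> g ^+ q = 1.
Proof.
move=> Gg; have [z Gz [k ->]] := mem_chain2 pp p_odd m_gt0 ellp ell3 genJ relAB Gg.
rewrite expgMn; last by apply: cG1 => //; rewrite !groupX.
rewrite (chain1_expg Gz) mul1g -expgM mulnC expgM -(expgM C) mulnn.
by rewrite (Cq2 pp p_odd m_gt0 ellp ell3 relAB) expg1n.
Qed.

Lemma chain2_commC g : g \in G2 -> commute g C.
Proof.
move=> Gg; have [z Gz [k ->]] := mem_chain2 pp p_odd m_gt0 ellp ell3 genJ relAB Gg.
apply/commute_sym/commuteM; first by apply/commute_sym/cG1.
by do 2!apply: commuteX.
Qed.

Section Elt.
Variables (k : gT) (x y : nat).
Hypothesis G2k : k \in G2.
Let u := k * A ^+ q ^+ x * B ^+ q ^+ y.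

Let AqG4 i : A ^+ q ^+ i \in G4. Proof. by apply/groupX/G34/Aq_chain3. Qed.
Let BqG4 i : B ^+ q ^+ i \in G4. Proof. by apply/groupX/Bq_chain4. Qed.
Let ZG i : Z ^+ i \in G1. Proof. exact: Z_chain1. Qed.
Let J4 g : g \in G4 -> g \in J := @sJ _ _ G4n.

Lemma elt_chain4 : u \in G4.
Proof. by rewrite !groupM // G24. Qed.

Lemma elt_expq : u ^+ q = Z ^+ x * Z ^- y.
Proof.
have k4 : k \in G4 by apply: G24.
rewrite /u !expgMn; try by apply: c4; rewrite ?groupM.
have E (g : gT) i : (g ^+ q ^+ i) ^+ q = (g ^+ (q ^ 2)) ^+ i.
  by rewrite -(expgM (g ^+ q)) (mulnC i) (expgM (g ^+ q)) -(expgM g) mulnn.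
by rewrite chain2_expg // mul1g !E (Bq2 pp p_odd m_gt0 ellp ell3 relAB) expgVn.
Qed.

Lemma elt_comm_C : [~ u, C] = Z ^+ (ell * (x + y)).
Proof.
have cA := comm_Aq_C relAB.
have cB := comm_Bq_C pp p_odd m_gt0 ellp ell3 relAB.
have JAq : A ^+ q \in J by exact: groupX.
have JBq : B ^+ q \in J by exact: groupX.
have fixZ i g : g \in J -> (Z ^+ i) ^ g = Z ^+ i.
  by move=> Jg; apply/conjg_fixP/commgP/cG1.
rewrite /u !commMgJ (eqP (introT commgP (chain2_commC G2k))) conj1g mul1g.
have cX g i : g \in J -> [~ g, C] = Z ^+ ell -> [~ g ^+ i, C] = Z ^+ (ell * i).
  move=> Jg E; have c : commute g [~ g, C] by rewrite E; apply/commute_sym/cG1.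
  by rewrite commXg // E -expgM.
by rewrite (cX _ _ _ cA) // (cX _ _ _ cB) // fixZ; [rewrite -expgD mulnDr | apply/J4/BqG4].
Qed.

Lemma elt_comm_B : exists2 z, z \in G1 & [~ u, B] = z * C ^+ q ^+ x.
Proof.
have [z1 Gz1 E] := Aq_B pp p_odd m_gt0 relAB.
have G2c : [~ k, B] \in G1 by apply: (comm_chain2 pp p_odd m_gt0 ellp ell3 genJ relAB).
have JAq : A ^+ q \in J by exact: groupX.
have c2 : [~ A ^+ q, B] \in G2 by apply: (Aq_B_chain2 pp p_odd m_gt0 relAB).
have /commgP/eqP cB : commute (B ^+ q ^+ y) B by apply/commute_sym/commuteX/commuteX.
exists ([~ k, B] * z1 ^+ x).
  by apply: groupM => //; apply: groupX.
rewrite /u !commMgJ cB mulg1 conjMg.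
have fix1 g h : g \in G1 -> h \in J -> g ^ h = g.
  by move=> Gg Jh; apply/conjg_fixP/commgP/cG1.
have [Jx Jy] := (J4 (AqG4 x), J4 (BqG4 y)).
rewrite !(fix1 [~ k, B]) // -(mulgA [~ k, B]); congr (_ * _).
rewrite commXg; last first.
  by apply: c4; [apply/G34/Aq_chain3 | apply: G24].
have -> : ([~ A ^+ q, B] ^+ x) ^ (B ^+ q ^+ y) = [~ A ^+ q, B] ^+ x.
  apply/conjg_fixP/commgP; apply: c4 => //; apply/groupX; exact: G24.
rewrite E expgMn; last by apply/commute_sym/cG1 => //; rewrite !groupX.
by apply/commute_sym/cG1; rewrite ?groupX // !groupX.
Qed.
End Elt.
End Perturb.

(** In use, a = [A, v], b = [u, B], e = [C, v] and f = [C, u]. *)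
Lemma commMM_expand (gT : finGroupType) (A B u v C a e f b : gT) :
    A ^ B = A * C -> A ^ v = A * a -> C ^ v = C * e -> u ^ v = u -> u ^ B = u * b ->
    b ^ v = b -> C * u = u * C * f -> commute a u -> commute e u ->
  [~ A * u, B * v] = a * C * f * e * b.
Proof.
move=> AB Av Cv uv uB bv Cu au eu; rewrite (commgEl (A * u)) conjgM [(A * u) ^ B]conjMg.
rewrite AB uB !conjMg Av Cv uv bv invMg.
transitivity (u^-1 * (a * (C * u) * e * b)).
  by rewrite -!mulgA mulKg (mulgA e) eu -!mulgA.
by rewrite Cu -!mulgA (mulgA a) au -!mulgA mulKg.
Qed.

Lemma mulg_shuffle (gT : finGroupType) (c X Y z f e w : gT) :
  commute (z * f * e * w) Y -> c * (X * z) * f * e * (w * Y) = c * (X * Y) * (z * f * e * w).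
Proof. by move=> cY; rewrite -[RHS]mulgA -(mulgA X) -cY !mulgA. Qed.

(** * When the perturbed pair satisfies the relations *)

Section Perturbed_pair.
Variables (p m ell : nat).
Hypotheses (pp : prime p) (p_odd : odd p) (m_gt0 : (0 < m)%N) (ellp : ~~ (p %| ell)).
Hypothesis ell3 : p = 3 -> m = 1%N -> ell = 1 %[mod 3].
Local Notation q := (p ^ m)%N.
Local Notation al := (1 + ell * q)%N.
Local Notation c3 := 'C(1 + ell * p ^ m, 3).
Local Notation rel := (J_relations p m al).
Variables (gT : finGroupType) (J : {group gT}) (A B : gT).
Hypothesis genJ : <<[set A; B]>> = J.
Hypothesis relAB : rel A B.
Hypothesis cardJ_ge : (q ^ 7 <= #|J|)%N.
Local Notation C := [~ A, B].
Local Notation Z := (A ^+ (q ^ 2)).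
Let JA := gen_memA genJ.
Let JB := gen_memB genJ.
Let JC : C \in J. Proof. by rewrite groupR. Qed.
Let genBA : <<[set B; A]>> = J. Proof. by rewrite setUC. Qed.
Let relBA := J_relations_sym relAB.

Let Z1E := ucn1E pp p_odd m_gt0 ellp ell3 genJ relAB cardJ_ge.
Let Z2E := ucn2E pp p_odd m_gt0 ellp ell3 genJ relAB cardJ_ge.
Let Z3E := ucn3E pp p_odd m_gt0 ellp ell3 genJ relAB cardJ_ge.
Let Z2E' := ucn2E pp p_odd m_gt0 ellp ell3 genBA relBA cardJ_ge.
Let Z1E' := ucn1E pp p_odd m_gt0 ellp ell3 genBA relBA cardJ_ge.

Let cAB : commute (A ^+ q) (B ^+ q) := commute_Aq_Bq pp p_odd m_gt0 ellp ell3 relAB.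

Let sZ n x : x \in 'Z_n(J) -> x \in J.
Proof. exact/subsetP/ucn_sub. Qed.
Let Z12 x : x \in 'Z_1(J) -> x \in 'Z_2(J).
Proof. exact/subsetP/ucn_subS. Qed.
Let Z23 x : x \in 'Z_2(J) -> x \in 'Z_3(J).
Proof. exact/subsetP/ucn_subS. Qed.
Let cZ1 h g : h \in 'Z_1(J) -> g \in J -> commute h g.
Proof. by rewrite ucn1 => /centerP[_ c] Jg; apply: c. Qed.
Let cZ3 x y : x \in 'Z_3(J) -> y \in 'Z_3(J) -> commute x y.
Proof.
rewrite Z3E => Gx Gy.
by apply: (centsP (chain4_abelian pp p_odd m_gt0 ellp ell3 genJ relAB)).
Qed.
Let fix1 h g : h \in 'Z_1(J) -> g \in J -> h ^ g = h.
Proof. by move=> Zh Jg; apply/conjg_fixP/commgP/cZ1. Qed.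
Let ZZ i : Z ^+ i \in 'Z_1(J). Proof. by rewrite Z1E Z_chain1. Qed.
Let Cq2i i : C ^+ q ^+ i \in 'Z_2(J). Proof. by rewrite Z2E groupX ?Cq_chain2. Qed.

Variables (k1 k2 : gT) (x1 y1 x2 y2 : nat).
Hypotheses (k1Z : k1 \in 'Z_2(J)) (k2Z : k2 \in 'Z_2(J)).
Let u := k1 * A ^+ q ^+ x1 * B ^+ q ^+ y1.
Let v := k2 * A ^+ q ^+ x2 * B ^+ q ^+ y2.

Let uZ : u \in 'Z_3(J).
Proof. by rewrite Z3E; apply: elt_chain4; rewrite -Z2E. Qed.
Let vZ : v \in 'Z_3(J).
Proof. by rewrite Z3E; apply: elt_chain4; rewrite -Z2E. Qed.

Lemma elt_comm_A k x y : k \in 'Z_2(J) ->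
  exists2 z, z \in 'Z_1(J) & [~ k * A ^+ q ^+ x * B ^+ q ^+ y, A] = z * C ^- q ^+ y.
Proof.
rewrite Z2E' => Gk; have [z Gz E] := elt_comm_B pp p_odd m_gt0 ellp ell3 genBA relBA y x Gk.
exists z; first by rewrite Z1E'.
rewrite -mulgA (commuteX2 _ _ cAB) mulgA E -[ [~ B, A]]invg_comm expgVn //.
Qed.

Let CqX_A i : [~ C ^- q ^+ i, A] = Z ^+ (ell * i).
Proof.
have CJ : C ^- q \in J by rewrite groupV groupX.
have E : [~ C ^- q, A] = Z ^+ ell.
  rewrite -(fix1 (ZZ ell) CJ) -(comm_A_Cq pp p_odd m_gt0 relAB).
  by rewrite !commgEl !conjgE !invgK !mulgA mulgK.
have c : commute (C ^- q) [~ C ^- q, A] by rewrite E; apply/commute_sym/cZ1.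
by rewrite commXg // E -expgM.
Qed.

Let A_CqX i : [~ A, C ^+ q ^+ i] = Z ^+ (ell * i).
Proof.
have E := comm_A_Cq pp p_odd m_gt0 relAB.
have c : commute (C ^+ q) [~ A, C ^+ q].
  by rewrite E; apply/commute_sym/cZ1 => //; apply: groupX.
by rewrite commgX // E -expgM.
Qed.

Let k1G : k1 \in chain2 p m A B. Proof. by rewrite -Z2E. Qed.

(** Besides C, the only factors of [commMM_expand] that are not central are [A, v] and [u, B], which
    are C^(q y2) and C^(q x1) up to the centre. *)
Lemma comm_perturb : exists2 z, z \in 'Z_1(J) &
  [~ A * u, B * v] = C * C ^+ q ^+ (x1 + y2) * z.
Proof.
have [z1 Zz1 E1] := elt_comm_B pp p_odd m_gt0 ellp ell3 genJ relAB x1 y1 k1G.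
have [z2 Zz2 E2] := elt_comm_A x2 y2 k2Z.
rewrite -/u in E1; rewrite -/v in E2; rewrite -Z1E in Zz1.
have [Ju Jv] : u \in J /\ v \in J by rewrite (sZ uZ) (sZ vZ).
have fZ g : g \in 'Z_3(J) -> [~ C, g] \in 'Z_1(J).
  move=> Zg; rewrite -groupV invg_comm; move: Zg; rewrite Z3E => Gg.
  have [h Gh [i [j ->]]] := mem_chain4 pp p_odd m_gt0 ellp ell3 genJ relAB Gg.
  by rewrite (elt_comm_C pp p_odd m_gt0 ellp ell3 genJ relAB).
have cqC i : commute (C ^+ q ^+ i) C by apply/commute_sym/commuteX/commuteX.
have Av : [~ A, v] = C ^+ q ^+ y2 * z2^-1.
  by rewrite -invg_comm E2 invMg expgVn invgK.
have uB : [~ u, B] \in 'Z_3(J).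
  by rewrite E1; apply: groupM; [apply/Z23/Z12 | apply/Z23/Cq2i].
set f := [~ C, u]; have Zf : f \in 'Z_1(J) by apply: fZ.
set e := [~ C, v]; have Ze : e \in 'Z_1(J) by apply: fZ.
have au : commute [~ A, v] u.
  apply: (cZ3 _ uZ); rewrite Av; apply: groupM; first exact/Z23/Cq2i.
  by rewrite groupV; apply/Z23/Z12.
have aC : commute [~ A, v] C.
  rewrite Av; apply/commute_sym/commuteM; first exact/commute_sym.
  by apply/commute_sym/cZ1; rewrite ?groupV.
have -> : [~ A * u, B * v] = C * [~ A, v] * f * e * [~ u, B].
  rewrite -aC; apply: commMM_expand => //.
  - by rewrite commgEl mulKVg.
  - by rewrite commgEl mulKVg.
  - by rewrite commgEl mulKVg.
  - by apply/conjg_fixP/commgP/cZ3.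
  - by rewrite commgEl mulKVg.
  - by apply/conjg_fixP/commgP/cZ3.
  - by rewrite commgC.
  - exact: cZ1.
clearbody e f; rewrite Av E1.
exists (z2^-1 * f * e * z1); first by rewrite !groupM ?groupV.
have JCq i : C ^+ q ^+ i \in J by rewrite !groupX.
rewrite addnC expgD; apply: mulg_shuffle.
by apply: cZ1 => //; rewrite !groupM ?groupV.
Qed.

(** The element t is [u, A], equal to C^(- q y1) up to the centre, whence [t, A] = Z^(l y1). *)
Lemma perturb_expg n :
  exists2 t, t \in 'Z_2(J) &
    (A * u) ^+ n = A ^+ n * (u ^+ n * t ^+ 'C(n, 2) * Z ^+ (ell * y1) ^+ 'C(n, 3)).
Proof.
have [z Zz E] := elt_comm_A x1 y1 k1Z; rewrite -/u in E.
have C2 : C ^- q ^+ y1 \in 'Z_2(J) by rewrite expgVn groupV.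
have Zt : [~ u, A] \in 'Z_2(J) by rewrite E; apply: groupM; [apply: Z12|].
exists [~ u, A] => //; apply: expMg_comm3.
- by rewrite commgEl mulKVg.
- rewrite -(CqX_A y1) -[LHS](mulKVg [~ u, A]) -commgEl E; congr (_ * _).
  have /commgP/eqP zA : commute z A by apply: cZ1.
  by rewrite commMgJ zA conj1g mul1g.
- exact: fix1.
- exact: (cZ3 uZ (Z23 Zt)).
- exact: (cZ3 uZ (Z23 (Z12 (ZZ _)))).
- exact/commute_sym/(cZ1 (ZZ _) (sZ Zt)).
Qed.

Let uq : u ^+ q = Z ^+ x1 * Z ^- y1.
Proof. by apply: (elt_expq pp p_odd m_gt0 ellp ell3 genJ relAB). Qed.
Let Zq2 : Z ^+ q = 1. Proof. exact: Zq relAB. Qed.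
Let order_q : #[Z] = q.
Proof. exact: (order_Z pp p_odd m_gt0 ellp ell3 genJ relAB cardJ_ge). Qed.
Let Z2q t : t \in 'Z_2(J) -> t ^+ q = 1.
Proof. by rewrite Z2E; apply: (chain2_expg pp p_odd m_gt0 ellp ell3 genJ relAB). Qed.

Lemma perturb_order : (A * u) ^+ (p ^ (3 * m)) = 1.
Proof.
rewrite (mulnC 3) expnM; have [t Zt ->] := perturb_expg (q ^ 3).
have oq3 : odd (q ^ 3)%N by rewrite !oddX p_odd !orbT.
have q3q2 : (q ^ 3 = q * q ^ 2)%N by rewrite -expnS.
have q_q3 : (q %| q ^ 3)%N by rewrite q3q2 dvdn_mulr.
rewrite (Aq3 relAB) (expg_dvd (Z2q Zt)) ?(dvdn_trans q_q3 (dvdn_bin2 oq3)) // mulg1 mul1g.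
rewrite [u ^+ _](_ : _ = 1) ?mul1g; last first.
  have ZX i : Z ^+ i ^+ q = 1 by rewrite -(expgM Z) (mulnC i) (expgM Z) Zq2 expg1n.
  rewrite q3q2 -mulnn expgM uq (expgM _ q q) expgMn; last by apply/commuteV/commuteX2.
  by rewrite ZX expgVn ZX invg1 mulg1 expg1n.
apply: (expg_dvd (n := q)).
  by rewrite -(expgM Z) (mulnC (ell * y1)%N) (expgM Z) Zq2 expg1n.
have := dvdn_3bin3 (q ^ 3).
have -> : (q ^ 3 = p ^ (m * 3))%N by rewrite expnM.
move/(dvdn_mul3 pp)/(_ (dvdnn p)).
have -> : (m * 3 = (m + (m * 2).-1).+1)%N by rewrite -addnS prednK ?muln_gt0 ?m_gt0 // -mulnS.
by rewrite expnS dvdn_pmul2l ?prime_gt0 // expnD => /(dvdn_trans (dvdn_mulr _ (dvdnn _))).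
Qed.

(** The conjugate is A^alpha u Z^(l (x1 + y2) + l (x1 + y1)), and the power is A^alpha u Z^(l (x1 -
    y1) + l y1 binom(alpha, 3)). As Z has order q and l is a unit, the exponents are compared modulo
    q. *)
Lemma perturb_A :
  (A * u) ^ [~ A * u, B * v] = (A * u) ^+ al <-> x1 + 2 * y1 + y2 = y1 * c3 %[mod q].
Proof.
have [z Zz ->] := comm_perturb.
have [t Zt ->] := perturb_expg al.
have Ju := sZ uZ.
have -> : t ^+ 'C(al, 2) = 1.
  apply: (expg_dvd (Z2q Zt)).
  have c2 : coprime q 2 by rewrite coprime_sym coprime2n oddX p_odd orbT.
  by rewrite -(Gauss_dvdl _ c2) bin2_double add1n /= mulnA dvdn_mull.
set s := (x1 + y2)%N.
set w := C ^+ q ^+ s.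
have Zw : w \in 'Z_2(J) := Cq2i s.
have -> : (A * u) ^ (C * w * z) = A ^+ al * (u * Z ^+ (ell * s * al + ell * (x1 + y1))).
  rewrite conjgM; have -> : forall g, g \in J -> g ^ z = g.
    by move=> g Jg; apply/conjg_fixP/commgP/commute_sym/cZ1.
  - rewrite conjgM [(A * u) ^ C]conjMg (AJC relAB).
    have -> : u ^ C = u * Z ^+ (ell * (x1 + y1)).
      by rewrite -(elt_comm_C pp p_odd m_gt0 ellp ell3 genJ relAB x1 y1 k1G) commgEl mulKVg.
    rewrite [(_ * _) ^ w]conjMg [(u * _) ^ w]conjMg (fix1 (ZZ _)) ?(sZ Zw) // conjXg.
    have -> : A ^ w = A * Z ^+ (ell * s) by rewrite -A_CqX commgEl mulKVg.
    have -> : u ^ w = u by apply/conjg_fixP/commgP; apply: (cZ3 uZ (Z23 Zw)).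
    rewrite expgMn; last by apply/commute_sym/cZ1.
    rewrite -(expgM Z) -mulgA; congr (_ * _); rewrite mulgA (cZ1 (ZZ _) Ju) -mulgA; congr (_ * _).
    by rewrite -expgD.
  - by apply: groupJ; [apply: groupM | apply: groupM (sZ Zw)].
have -> : u ^+ al = u * (Z ^+ (ell * x1) * Z ^- (ell * y1)).
  rewrite expgD expg1 (mulnC ell) expgM uq expgMn; last by apply/commuteV/commuteX2.
  by rewrite expgVn -!(expgM Z) !(mulnC _ ell).
rewrite mulg1 -(expgM Z) -[u * _ * _]mulgA.
have -> : (ell * s * al + ell * (x1 + y1) = ell * (x1 + (s + y1)) + q * (ell * ell * s))%N by ring.
rewrite [Z ^+ (_ + q * _)]expgD [Z ^+ (q * _)]expgM Zq2 expg1n mulg1.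
have core : Z ^+ (ell * (x1 + (s + y1))) =
    Z ^+ (ell * x1) * Z ^- (ell * y1) * Z ^+ (ell * y1 * c3) <->
    x1 + 2 * y1 + y2 = y1 * c3 %[mod q].
  have E : Z ^+ (ell * (x1 + (s + y1))) =
      Z ^+ (ell * x1) * Z ^- (ell * y1) * Z ^+ (ell * y1 * c3) <->
      Z ^+ (ell * x1 + ell * (s + y1 + y1)) = Z ^+ (ell * x1 + ell * (y1 * c3)).
    have -> : (ell * x1 + ell * (s + y1 + y1) = ell * (x1 + (s + y1)) + ell * y1)%N by ring.
    rewrite !(expgD Z).
    have cV : commute (Z ^- (ell * y1)) (Z ^+ (ell * y1 * c3)).
      exact/commute_sym/commuteV/commuteX2.
    rewrite -mulgA cV (mulnA ell y1) mulgA; split=> [->|E].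
      by rewrite mulgKV.
    by rewrite -E mulgK.
  rewrite E; split=> [/eqP|e].
    rewrite eq_expg_mod_order order_q eqn_modDl => /eqP e.
    have co : coprime ell q by rewrite coprimeXr // coprime_sym prime_coprime.
    by rewrite -(modn_coprime_inj co e) /s; congr (_ %% _); ring.
  apply/eqP; rewrite eq_expg_mod_order order_q eqn_modDl -modnMmr.
  by rewrite (_ : s + y1 + y1 = x1 + 2 * y1 + y2)%N ?e ?modnMmr // /s; ring.
rewrite -core; split=> [/mulgI/mulgI // | -> //].
Qed.
End Perturbed_pair.

Section Perturbed_relations.
Variables (p m ell : nat).
Hypotheses (pp : prime p) (p_odd : odd p) (m_gt0 : (0 < m)%N) (ellp : ~~ (p %| ell)).
Hypothesis ell3 : p = 3 -> m = 1%N -> ell = 1 %[mod 3].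
Local Notation q := (p ^ m)%N.
Local Notation al := (1 + ell * q)%N.
Local Notation c3 := 'C(1 + ell * p ^ m, 3).
Local Notation rel := (J_relations p m al).
Variables (gT : finGroupType) (J : {group gT}) (A B : gT).
Hypothesis genJ : <<[set A; B]>> = J.
Hypothesis relAB : rel A B.
Hypothesis cardJ_ge : (q ^ 7 <= #|J|)%N.
Let JA := gen_memA genJ.
Let JB := gen_memB genJ.
Let genBA : <<[set B; A]>> = J. Proof. by rewrite setUC. Qed.
Let relBA := J_relations_sym relAB.

Let cAB : commute (A ^+ q) (B ^+ q) := commute_Aq_Bq pp p_odd m_gt0 ellp ell3 relAB.
Let swap k x y : k * A ^+ q ^+ x * B ^+ q ^+ y = k * B ^+ q ^+ y * A ^+ q ^+ x.
Proof. by rewrite -!mulgA (commuteX2 x y cAB). Qed.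

(** Exchanging the generators sends (x1, y1, x2, y2) to (y2, x2, y1, x1), which turns the first
    congruence into the second. *)
Lemma J_relations_perturb k1 k2 x1 y1 x2 y2 : k1 \in 'Z_2(J) -> k2 \in 'Z_2(J) ->
  rel (A * (k1 * A ^+ q ^+ x1 * B ^+ q ^+ y1)) (B * (k2 * A ^+ q ^+ x2 * B ^+ q ^+ y2)) <->
  x1 + 2 * y1 + y2 = y1 * c3 %[mod q] /\ y2 + 2 * x2 + x1 = x2 * c3 %[mod q].
Proof.
move=> Zk1 Zk2.
have P1 := perturb_A pp p_odd m_gt0 ellp ell3 genJ relAB cardJ_ge x1 y1 x2 y2 Zk1 Zk2.
have P2 := perturb_A pp p_odd m_gt0 ellp ell3 genBA relBA cardJ_ge y2 x2 y1 x1 Zk2 Zk1.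
have O1 := perturb_order pp p_odd m_gt0 ellp ell3 genJ relAB cardJ_ge x1 y1 Zk1.
have O2 := perturb_order pp p_odd m_gt0 ellp ell3 genBA relBA cardJ_ge y2 x2 Zk2.
rewrite -!swap in P2 O2; split=> [[r1 r2 _ _]|[c1 c2]].
  by split; [apply/P1 | apply/P2].
by split=> //; [apply/P1 | apply/P2].
Qed.
End Perturbed_relations.

(** * Automorphisms *)

Section Automorphisms.
Variables (gT : finGroupType) (J : {group gT}) (A B : gT).
Hypothesis genJ : <<[set A; B]>> = J.
Let JA := gen_memA genJ.
Let JB := gen_memB genJ.

Lemma Aut_M s : s \in Aut J -> {in J &, {morph s : x y / x * y}}.
Proof. by move=> sA; apply/morphicP/Aut_morphic. Qed.

Lemma coset_eqE (N : {group gT}) a b : a \in 'N(N) -> b \in 'N(N) ->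
  (coset N a == coset N b) = (a^-1 * b \in N).
Proof.
move=> na nb; apply/eqP/idP => [e | h].
  by apply: coset_idr; rewrite ?groupM ?groupV // morphM ?groupV //= morphV //= e mulVg.
have := coset_id h; rewrite morphM ?groupV //= morphV //= => e.
by apply: (mulgI (coset N a)^-1); rewrite mulVg e.
Qed.

Lemma Aut_coset_gen (N : {group gT}) s t : N <| J -> s \in Aut J -> t \in Aut J ->
    (s A)^-1 * t A \in N -> (s B)^-1 * t B \in N ->
  forall x, x \in J -> coset N (s x) = coset N (t x).
Proof.
move=> /andP[_ /subsetP nN] sA tA eA eB x Jx.
have nJ (r : {perm gT}) y : r \in Aut J -> y \in J -> r y \in 'N(N).
  by move=> rA Jy; apply/nN/Aut_closed.
pose K := [set x in J | coset N (s x) == coset N (t x)].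
have gK : group_set K.
  apply/group_setP; split=> [|y z]; rewrite !inE.
    have r1 (r : {perm gT}) : r \in Aut J -> r 1 = 1 by move=> rA; apply: (morph1 (autm_morphism rA)).
    rewrite group1 /= (r1 s) // (r1 t) // eqxx //.
  case/andP=> Jy /eqP ey /andP[Jz /eqP ez]; rewrite groupM //= !Aut_M //.
  by rewrite !morphM ?nJ //= ey ez.
have : J \subset Group gK.
  by apply: (gen2_sub genJ); rewrite /= inE ?JA ?JB coset_eqE ?nJ.
by move/subsetP/(_ x Jx); rewrite /= inE => /andP[_ /eqP].
Qed.

Lemma AutnE n s : s \in Aut J ->
  (s \in Autn n J) = (A^-1 * s A \in 'Z_n(J)) && (B^-1 * s B \in 'Z_n(J)).
Proof.
move=> sA; have nN := subsetP (normal_norm (ucn_normal n J)).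
have nJ y : y \in J -> s y \in 'N('Z_n(J)) by move=> Jy; apply/nN/Aut_closed.
apply/AutnP/andP => [[_ e] | [eA eB]].
  by rewrite -!coset_eqE ?nJ ?nN // !e.
split=> // x Jx; apply/esym.
have := @Aut_coset_gen [group of 'Z_n(J)] 1 s (ucn_normal n J) (group1 _) sA.
by rewrite !perm1 => /(_ eA eB x Jx); rewrite perm1.
Qed.

Lemma Aut_eq s t : s \in Aut J -> t \in Aut J -> s A = t A -> s B = t B -> s = t.
Proof.
move=> sA tA eA eB; apply: (eq_Aut sA tA) => x Jx.
have := Aut_coset_gen (normal1 J) sA tA; rewrite eA eB !mulVg group1 => /(_ isT isT x Jx)/eqP.
rewrite coset_eqE ?norm1 ?in_setT // => /set1P/eqP; by rewrite -eq_mulVg1 => /eqP.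
Qed.

End Automorphisms.

Lemma isog_quotient_Zp (gT : finGroupType) (H G : {group gT}) d n :
    (1 < n)%N -> G = <[d]> * H :> {set gT} -> G \subset 'N(H) -> #|G| = (#|H| * n)%N ->
  G / H \isog [set: 'Z_n].
Proof.
move=> n1 GE nHG cG.
have sHG : H \subset G by rewrite GE mulG_subr.
have nd : d \in 'N(H).
  by apply: (subsetP nHG); have := mem_mulg (cycle_id d) (group1 H); rewrite mulg1 -GE.
have cyc : G / H = <[coset H d]> by rewrite GE quotientMidr quotient_cycle.
rewrite isog_cyclic_card /= cyc ?cycle_cyclic // -cyc card_quotient //.
rewrite -(eqn_pmul2l (cardG_gt0 H)) Lagrange // cG cardsT card_ord Zp_cast // eqxx andbT.
by rewrite Zp_cycle cycle_cyclic.
Qed.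

(** * The order of J, Aut_2, and the morphism from Aut_3 to Z_3 / Z_2 *)

Section Main.
Variables (p m ell : nat).
Hypotheses (pp : prime p) (p_odd : odd p) (m_gt0 : (0 < m)%N) (ellp : ~~ (p %| ell)).
Hypothesis ell3 : p = 3 -> m = 1%N -> ell = 1 %[mod 3].
Local Notation q := (p ^ m)%N.
Local Notation al := (1 + ell * q)%N.
Local Notation c3 := 'C(1 + ell * p ^ m, 3).
Local Notation rel := (J_relations p m al).
Variables (gT : finGroupType) (J : {group gT}) (A B : gT).
Hypothesis presJ : presents_J p m al J A B.
Let genJ : <<[set A; B]>> = J. Proof. by case: presJ. Qed.
Let relAB : rel A B. Proof. by case: presJ. Qed.

(** The universal property maps J onto the group generated by the two permutations of the model. *)
Lemma card_J_ge : (q ^ 7 <= #|J|)%N.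
Proof.
have [_ _ /(_ _ _ _ (model_rel pp p_odd m_gt0 ellp))[f [fM fA fB]]] := presJ.
pose F := Morphism fM.
apply: leq_trans (leq_morphim F J).
have JA := gen_memA genJ; have JB := gen_memB genJ.
apply: (@model_card _ _ _ pp p_odd m_gt0 ellp (F @* J)%G).
  by rewrite -fA -[f A]/(F A) mem_morphim.
by rewrite -fB -[f B]/(F B) mem_morphim.
Qed.

Let cardJ_ge := card_J_ge.
Let JA := gen_memA genJ.
Let JB := gen_memB genJ.
Local Notation C := [~ A, B].
Local Notation Z := (A ^+ (q ^ 2)).
Let JC : C \in J. Proof. by rewrite groupR. Qed.
Let genBA : <<[set B; A]>> = J. Proof. by rewrite setUC. Qed.
Let relBA := J_relations_sym relAB.
Let Z1E := ucn1E pp p_odd m_gt0 ellp ell3 genJ relAB cardJ_ge.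
Let Z2E := ucn2E pp p_odd m_gt0 ellp ell3 genJ relAB cardJ_ge.
Let Z3E := ucn3E pp p_odd m_gt0 ellp ell3 genJ relAB cardJ_ge.
Let Z4E := ucn4E pp p_odd m_gt0 ellp ell3 genJ relAB cardJ_ge.
Let cAB : commute (A ^+ q) (B ^+ q) := commute_Aq_Bq pp p_odd m_gt0 ellp ell3 relAB.
Let pert := J_relations_perturb pp p_odd m_gt0 ellp ell3 genJ relAB cardJ_ge.
Let q1 : (1 < q)%N := q_gt1 pp m_gt0.
Let q0 : (0 < q)%N := ltnW q1.

Let cards := card_chain pp p_odd m_gt0 ellp ell3 genJ relAB cardJ_ge.
Lemma card_J : #|J| = (q ^ 7)%N. Proof. by have [_ _ _ _ []] := cards. Qed.
Lemma card_Z1 : #|'Z_1(J)| = q. Proof. by rewrite Z1E; have [] := cards. Qed.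
Lemma card_Z2 : #|'Z_2(J)| = (q ^ 2)%N. Proof. by rewrite Z2E; have [] := cards. Qed.
Lemma card_Z3 : #|'Z_3(J)| = (q ^ 4)%N. Proof. by rewrite Z3E; have [] := cards. Qed.
Lemma card_Z4 : #|'Z_4(J)| = (q ^ 5)%N.
Proof. by rewrite Z4E; have [_ _ _ _ []] := cards. Qed.

Lemma memZ3 g : g \in 'Z_3(J) ->
  exists2 k, k \in 'Z_2(J) & exists x y, g = k * A ^+ q ^+ x * B ^+ q ^+ y.
Proof. by rewrite Z3E Z2E; apply: (mem_chain4 pp p_odd m_gt0 ellp ell3 genJ relAB). Qed.

Let Z23 x : x \in 'Z_2(J) -> x \in 'Z_3(J).
Proof. exact/subsetP/ucn_subS. Qed.
Let sZ n x : x \in 'Z_n(J) -> x \in J.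
Proof. exact/subsetP/ucn_sub. Qed.

Lemma eltZ3 k x y : k \in 'Z_2(J) -> k * A ^+ q ^+ x * B ^+ q ^+ y \in 'Z_3(J).
Proof. by rewrite Z2E Z3E => Gk; apply: elt_chain4. Qed.

Lemma J_pgroup : p.-group J.
Proof. by rewrite /pgroup card_J -expnM pnatX pnat_id. Qed.

(** Z_3 is generated by q-th powers, and p-th powers lie in the Frattini subgroup of a p-group.
    Perturbing generators by Z_3 thus keeps them generating. *)
Lemma ucn3_sub_Phi : 'Z_3(J) \subset 'Phi(J).
Proof.
have pq g : g \in J -> g ^+ q \in 'Phi(J).
  move=> Jg; rewrite (Phi_joing J_pgroup) mem_gen // inE; apply/orP; right.
  rewrite -[m]prednK // expnSr expgM.
  have := @Mho_p_elt 1 _ J p (g ^+ (p ^ m.-1)); rewrite expn1; apply.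
    exact: groupX.
  by apply: mem_p_elt J_pgroup _; apply: groupX.
rewrite Z3E !join_subG !cycle_subG -!andbA; apply/and4P; split; try exact: pq.
by rewrite -mulnn expgM groupX ?pq.
Qed.

(** The universal property gives an endomorphism; it is onto because Z_3 consists of non-generators,
    hence bijective by finiteness. *)
Lemma exists_aut u v : u \in 'Z_3(J) -> v \in 'Z_3(J) -> rel (A * u) (B * v) ->
  exists2 s : {perm gT}, s \in Aut J & s A = A * u /\ s B = B * v.
Proof.
move=> Zu Zv r.
have [_ _ /(_ _ _ _ r)[f [fM fA fB]]] := presJ.
pose F := Morphism fM.
have imF : F @* J = J.
  transitivity (F @* <<[set A; B]>>); first by rewrite genJ.
  rewrite morphim_gen; last by apply/subsetP => x /set2P[]->.
  have -> : F @* [set A; B] = [set A * u; B * v].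
    rewrite morphimU !morphim_set1 //= ?fA ?fB //.
  have JAu : A * u \in J by rewrite groupM // (sZ Zu).
  have JBv : B * v \in J by rewrite groupM // (sZ Zv).
  apply: Phi_nongen; apply/eqP; rewrite eqEsubset join_subG Phi_sub /=.
  apply/andP; split; first by apply/subsetP => x /set2P[]->.
  have P x : x \in 'Z_3(J) -> x \in 'Phi(J) <*> [set A * u; B * v].
    by move=> Zx; rewrite mem_gen // inE (subsetP ucn3_sub_Phi).
  apply: (gen2_sub genJ).
    rewrite -[X in X \in _](mulgK u); apply: groupM; last by rewrite groupV; apply: P.
    by rewrite mem_gen // !inE eqxx !orbT.
  rewrite -[X in X \in _](mulgK v); apply: groupM; last by rewrite groupV; apply: P.
  by rewrite mem_gen // !inE eqxx !orbT.
have injF : 'injm F by rewrite -card_im_injm imF.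
exists (aut injF imF); first exact: Aut_aut.
by rewrite !autE.
Qed.

Lemma Aut_rel s : s \in Aut J -> rel (s A) (s B).
Proof.
move=> sA; have sM := Aut_M sA; pose F := autm_morphism sA.
have [r1 r2 r3 r4] := relAB.
have FX g n : g \in J -> F (g ^+ n) = F g ^+ n by move=> Jg; rewrite morphX.
have FR g h : g \in J -> h \in J -> F [~ g, h] = [~ F g, F h] by move=> *; rewrite morphR.
have FJ g h : g \in J -> h \in J -> F (g ^ h) = F g ^ F h by move=> *; rewrite morphJ.
rewrite -[s A]/(F A) -[s B]/(F B); split.
- by rewrite -FR // -FJ ?groupR // r1 FX.
- by rewrite -FR // -FJ ?groupR // r2 FX.
- by rewrite -FX // r3 morph1.
- by rewrite -FX // r4 morph1.
Qed.

Let p2 : ~~ (p %| 2).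
Proof. by rewrite dvdn_prime2 //; apply: contraTneq p_odd => ->. Qed.

(* 2 - c3 is a unit modulo q: p divides c3 unless p = 3 and m = 1, when c3 = 1
   modulo 3 by the assumption on l. *)
Lemma mul_c3_eq_double x : 2 * x = x * c3 %[mod q] -> q %| x.
Proof.
move=> e; set t := (c3 + 2 * q.-1)%N.
have t2 : (t + 2 = c3 + 2 * q)%N.
  by rewrite /t -addnA; congr (_ + _)%N; rewrite -mulnSr prednK.
have qt : q %| x * t.
  rewrite mulnDr /dvdn -modnDml -e modnDml mulnCA -mulnDr -mulnS prednK //.
  by rewrite mulnA modnMl.
move: qt; rewrite Gauss_dvdl // coprimeXl // prime_coprime //; apply/negP => pt.
have pq : p %| 2 * q by rewrite dvdn_mull // dvdn_exp.
case: (bin3_alpha_modp pp p_odd m_gt0 ell3) => [pc|[p3 c31 _]].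
  by move: p2; rewrite -(dvdn_addr 2 pt) t2 dvdn_add.
have t3 : 3 %| t by rewrite -{1}p3.
have q3 : 3 %| 2 * q by rewrite -{1}p3.
have : 2 = 1 %[mod 3].
  by rewrite -(modnMDl (t %/ 3) 2 3) divnK // t2 -modnDmr (eqP q3) addn0.
by [].
Qed.

Lemma Autn_mulA n s : s \in Autn n J -> exists2 u, u \in 'Z_n(J) & s A = A * u.
Proof.
move=> sn; have sA := subsetP (Autn_sub J n) s sn.
by move: sn; rewrite (AutnE genJ) // => /andP[h _]; exists (A^-1 * s A); rewrite ?mulKVg.
Qed.

Lemma Autn_mulB n s : s \in Autn n J -> exists2 u, u \in 'Z_n(J) & s B = B * u.
Proof.
move=> sn; have sA := subsetP (Autn_sub J n) s sn.
by move: sn; rewrite (AutnE genJ) // => /andP[_ h]; exists (B^-1 * s B); rewrite ?mulKVg.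
Qed.

(** For x1 = y1 = x2 = y2 = 0 both congruences hold, so every pair of elements of Z_2 comes from an
    automorphism. *)
Lemma card_Autn2 : #|Autn 2 J| = (q ^ 4)%N.
Proof.
have -> : (q ^ 4 = #|setX 'Z_2(J) 'Z_2(J)|)%N by rewrite cardsX card_Z2 -expnD.
have inj : {in Autn 2 J &, injective (fun s : {perm gT} => (A^-1 * s A, B^-1 * s B))}.
  move=> s t /(subsetP (Autn_sub J 2)) sA /(subsetP (Autn_sub J 2)) tA [/mulgI eA /mulgI eB].
  exact: (Aut_eq genJ).
rewrite -(card_in_imset inj); congr #|pred_of_set _|; apply/setP => -[u v].
rewrite in_setX; apply/imsetP/andP => [[s sn [-> ->]] | [/= Zu Zv]].
  by have sA := subsetP (Autn_sub J 2) s sn; move: sn; rewrite (AutnE genJ) // => /andP.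
have E k : k * A ^+ q ^+ 0 * B ^+ q ^+ 0 = k by rewrite !expg0 !mulg1.
have [] := exists_aut (Z23 Zu) (Z23 Zv).
  by rewrite -(E u) -(E v); apply/pert.
move=> s sA [eA eB]; exists s; last by rewrite eA eB !mulKg.
by rewrite (AutnE genJ) // eA eB !mulKg Zu.
Qed.

Let ZZ i : Z ^+ i \in 'Z_2(J).
Proof. by apply: (subsetP (ucn_subS 1 J)); rewrite Z1E Z_chain1. Qed.

Lemma perturb_expg_ucn2 u : u \in 'Z_3(J) ->
  (A ^+ q)^-1 * (A * u) ^+ q \in 'Z_2(J) /\ (B ^+ q)^-1 * (B * u) ^+ q \in 'Z_2(J).
Proof.
move=> /memZ3[k Zk [x [y uE]]].
have uq : u ^+ q \in 'Z_2(J).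
  rewrite uE (elt_expq pp p_odd m_gt0 ellp ell3 genJ relAB) -?Z2E //.
  by rewrite groupM ?groupV ?ZZ.
have BZ i : B ^+ (q ^ 2) ^+ i \in 'Z_2(J).
  by rewrite (Bq2 pp p_odd m_gt0 ellp ell3 relAB) expgVn groupV ZZ.
have [t Zt E] := perturb_expg pp p_odd m_gt0 ellp ell3 genJ relAB cardJ_ge x y Zk q.
have [t' Zt' E'] := perturb_expg pp p_odd m_gt0 ellp ell3 genBA relBA cardJ_ge y x Zk q.
have swap : k * B ^+ q ^+ y * A ^+ q ^+ x = u.
  by rewrite uE -!mulgA (commuteX2 x y cAB).
rewrite -uE in E; rewrite swap in E'; rewrite E E' !mulKg.
split; (apply: groupM; first by apply: groupM; [|apply: groupX]).
  exact/groupX/ZZ.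
exact/groupX/BZ.
Qed.

(** For w in Z_3, (A w)^q = A^q and (B w)^q = B^q modulo Z_2, and A^q, B^q generate Z_3 / Z_2. This
    is what makes [chi] multiplicative. *)
Lemma Autn3_Z3 t u : t \in Autn 3 J -> u \in 'Z_3(J) ->
  coset 'Z_2(J) (t u) = coset 'Z_2(J) u.
Proof.
move=> t3 Zu; have tA := subsetP (Autn_sub J 3) t t3.
have nN := subsetP (normal_norm (ucn_normal 2 J)).
have tM := Aut_M tA; have tJ x : x \in J -> t x \in J := fun Jx => Aut_closed tA Jx.
have tX g n : g \in J -> t (g ^+ n) = t g ^+ n.
  by move=> Jg; apply: (morphX (autm_morphism tA)).
have [k Zk [x [y ->]]] := memZ3 Zu.
have tk : t k \in 'Z_2(J).
  have /charP[_ /(_ (autm_morphism tA) (injm_autm tA) (im_autm tA)) <-] := ucn_char 2 J.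
  by rewrite -[t k]/(autm tA k) mem_morphim // (sZ Zk).
have [Jk JAq JBq] : [/\ k \in J, A ^+ q \in J & B ^+ q \in J].
  by rewrite !groupX // (sZ Zk).
have [JAx JBy] : A ^+ q ^+ x \in J /\ B ^+ q ^+ y \in J by rewrite !groupX.
have [eA eB] : coset 'Z_2(J) (t (A ^+ q)) = coset 'Z_2(J) (A ^+ q) /\
               coset 'Z_2(J) (t (B ^+ q)) = coset 'Z_2(J) (B ^+ q).
  have [v Zv vE] := Autn_mulA t3; have [w Zw wE] := Autn_mulB t3.
  have [hA _] := perturb_expg_ucn2 Zv; have [_ hB] := perturb_expg_ucn2 Zw.
  split; apply/esym/eqP; (rewrite coset_eqE; [|exact: nN | exact/nN/tJ]).
    by rewrite tX // vE.
  by rewrite tX // wE.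
have cM g h : g \in J -> h \in J -> coset 'Z_2(J) (g * h) = coset 'Z_2(J) g * coset 'Z_2(J) h.
  by move=> Jg Jh; apply: (morphM (coset_morphism _)); apply: nN.
have cX g n : g \in J -> coset 'Z_2(J) (g ^+ n) = coset 'Z_2(J) g ^+ n.
  by move=> Jg; apply: (morphX (coset_morphism _)); apply: nN.
have JkA : k * A ^+ q ^+ x \in J by apply: groupM.
have JkA' : t k * t (A ^+ q) ^+ x \in J by apply: groupM; [apply: tJ | apply/groupX/tJ].
rewrite tM // tM // tX // [t (_ ^+ y)]tX // cM //; last exact/groupX/tJ.
rewrite [in RHS]cM // [in RHS]cM // [in LHS]cM ?tJ //; last exact/groupX/tJ.
rewrite (coset_id tk) (coset_id Zk) (cX _ x (tJ _ JAq)) (cX _ y (tJ _ JBq)) eA eB.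
by rewrite (cX _ x JAq) (cX _ y JBq).
Qed.

Definition chi (s : {perm gT}) := coset 'Z_2(J) (A^-1 * s A).

Lemma chi_morph : {in Autn 3 J &, {morph chi : s t / s * t}}.
Proof.
move=> s t s3 t3; have tA := subsetP (Autn_sub J 3) t t3.
have sA := subsetP (Autn_sub J 3) s s3.
have nN := subsetP (normal_norm (ucn_normal 2 J)).
have [u Zu uE] := Autn_mulA s3; have [v Zv vE] := Autn_mulA t3.
rewrite /chi permM uE (Aut_M tA) ?(sZ Zu) // vE -mulgA !mulKg.
have Jtu := Aut_closed tA (sZ Zu).
rewrite morphM ?nN ?(sZ Zv) //= Autn3_Z3 // -!morphM ?nN ?(sZ Zv) ?(sZ Zu) //=.
congr (coset _ _); move: Zu Zv; rewrite Z3E => Gu Gv.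
by apply: (centsP (chain4_abelian pp p_odd m_gt0 ellp ell3 genJ relAB)).
Qed.

Canonical chi_morphism := Morphism chi_morph.

(** With x1 = y1 = 0 the system becomes y2 = 0 and 2 x2 = x2 binom(alpha, 3), so x2 = 0 by
    [mul_c3_eq_double]. *)
Lemma ker_chi : 'ker chi_morphism = Autn 2 J.
Proof.
have nN := subsetP (normal_norm (ucn_normal 2 J)).
apply/setP => s; apply/idP/idP => [/morphpreP[s3 /set1P /= e] | s2].
  have sA := subsetP (Autn_sub J 3) s s3.
  have [u Zu uE] := Autn_mulA s3; have [v Zv vE] := Autn_mulB s3.
  have Zu2 : u \in 'Z_2(J).
    by apply: coset_idr; [exact: nN (sZ Zu) | rewrite -e /chi uE mulKg].
  rewrite (AutnE genJ) // uE vE !mulKg Zu2 /=.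
  have [k Zk [x [y vE2]]] := memZ3 Zv.
  have := Aut_rel sA; rewrite uE vE vE2.
  rewrite -[u in A * u]mulg1 -[u * 1]mulg1 -{1}(expg0 (A ^+ q)) -(expg0 (B ^+ q)).
  case/pert => // c1 c2.
  have qy : q %| y by move: c1; rewrite muln0 !add0n mul0n => /eqP; rewrite mod0n.
  have qx : q %| x.
    by apply: mul_c3_eq_double; rewrite -c2 addn0 -[RHS]modnDml (eqP qy) add0n.
  have Bq : (B ^+ q) ^+ q \in 'Z_2(J).
    by rewrite -expgM mulnn (Bq2 pp p_odd m_gt0 ellp ell3 relAB) groupV -[Z]expg1 ZZ.
  have Aq : (A ^+ q) ^+ q \in 'Z_2(J) by rewrite -expgM mulnn -[Z]expg1 ZZ.
  apply: groupM; last exact: (@dvd_mem p m gT [group of 'Z_2(J)]).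
  by apply: groupM => //; exact: (@dvd_mem p m gT [group of 'Z_2(J)]).
have sA := subsetP (Autn_sub J 2) s s2.
have := s2; rewrite (AutnE genJ) // => /andP[hA hB].
apply/morphpreP; split; first by rewrite (AutnE genJ) // !Z23.
by apply/set1P; rewrite /= /chi coset_id.
Qed.

Let nN x : x \in J -> x \in 'N('Z_2(J)).
Proof. by move=> Jx; apply: (subsetP (normal_norm (ucn_normal 2 J))). Qed.
Let cM g h : g \in J -> h \in J -> coset 'Z_2(J) (g * h) = coset 'Z_2(J) g * coset 'Z_2(J) h.
Proof. by move=> Jg Jh; apply: (morphM (coset_morphism _)); apply: nN. Qed.
Let cX g n : g \in J -> coset 'Z_2(J) (g ^+ n) = coset 'Z_2(J) g ^+ n.
Proof. by move=> Jg; apply: (morphX (coset_morphism _)); apply: nN. Qed.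
Let JAq : A ^+ q \in J. Proof. exact: groupX. Qed.
Let JBq : B ^+ q \in J. Proof. exact: groupX. Qed.
Local Notation a := (coset 'Z_2(J) (A ^+ q)).
Local Notation b := (coset 'Z_2(J) (B ^+ q)).

Let aq : a ^+ q = 1.
Proof. by rewrite -cX // -expgM mulnn coset_id // -[Z]expg1 ZZ. Qed.
Let bq : b ^+ q = 1.
Proof.
rewrite -cX // -expgM mulnn coset_id // (Bq2 pp p_odd m_gt0 ellp ell3 relAB).
by rewrite groupV -[Z]expg1 ZZ.
Qed.
Let cab : commute a b.
Proof. by rewrite /commute -!cM // cAB. Qed.
Let AqZ : A ^+ q \in 'Z_3(J).
Proof. by rewrite Z3E; apply: (subsetP (chain3_sub4 p m A B)); apply: Aq_chain3. Qed.
Let BqZ : B ^+ q \in 'Z_3(J).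
Proof. by rewrite Z3E; apply: Bq_chain4. Qed.

Lemma mem_ucn_quo c : c \in 'Z_3(J) / 'Z_2(J) -> exists x y, c = a ^+ x * b ^+ y.
Proof.
case/morphimP => g ng Zg ->; have [k Zk [x [y ->]]] := memZ3 Zg; exists x, y.
have [JAx JBy] : A ^+ q ^+ x \in J /\ B ^+ q ^+ y \in J by rewrite !groupX.
have Jk := sZ Zk.
have JkA : k * A ^+ q ^+ x \in J by apply: groupM.
by rewrite /= cM // cM // (coset_id Zk) mul1g (cX x JAq) (cX y JBq).
Qed.

Lemma card_ucn_quo : #|'Z_3(J) / 'Z_2(J)| = (q ^ 2)%N.
Proof.
rewrite card_quotient; last exact: subset_trans (ucn_sub 3 J) (ucn_norm 2 J).
apply/eqP; rewrite -(eqn_pmul2l (cardG_gt0 [group of 'Z_2(J)])).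
by rewrite Lagrange ?ucn_subS // card_Z2 card_Z3 -expnD.
Qed.

Definition zmap (ij : 'Z_q * 'Z_q) := a ^+ ij.1 * b ^+ ij.2.

Lemma zmap_morph : {in [set: 'Z_q * 'Z_q] &, {morph zmap : x y / x * y}}.
Proof.
case=> i j [i' j'] _ _; rewrite /zmap /=.
have E (c : coset_of 'Z_2(J)) (x y : 'Z_q) : c ^+ q = 1 -> c ^+ ((x * y)%g : 'Z_q) = c ^+ x * c ^+ y.
  move=> cq; have cq' : c ^+ (Zp_trunc q).+2 = 1 by rewrite Zp_cast.
  by rewrite -expgD -(expg_mod (x + y) cq').
rewrite !E // -!mulgA; congr (_ * _); rewrite !mulgA; congr (_ * _).
exact: commuteX2.
Qed.
Canonical zmap_morphism := Morphism zmap_morph.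

Lemma ucn_quo_isog : 'Z_3(J) / 'Z_2(J) \isog [set: 'Z_q * 'Z_q].
Proof.
have im : zmap_morphism @* [set: 'Z_q * 'Z_q] = 'Z_3(J) / 'Z_2(J).
  apply/setP => c; apply/morphimP/idP => [[[i j] _ _ ->] | /mem_ucn_quo[x [y ->]]].
    by rewrite /= /zmap; apply: groupM; apply: groupX; apply: mem_quotient.
  exists (inZp x, inZp y); rewrite ?inE //= /zmap /=.
  by rewrite !Zp_cast // !expg_mod.
have inj : 'injm zmap_morphism.
  by rewrite -card_im_injm im card_ucn_quo cardsT card_prod !card_ord !Zp_cast // mulnn.
have h : [set: 'Z_q * 'Z_q] \isog 'Z_3(J) / 'Z_2(J) by rewrite -im sub_isog.
by rewrite isog_sym.
Qed.

(** * Generators, quotients and orders, given Delta *)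

Variable Delta : {perm gT}.
Hypothesis DeltaA : Delta \in Aut J.
Hypothesis Delta_A : Delta A = A * B ^+ q.
Hypothesis Delta_B : exists2 v, v \in 'Z_3(J) & Delta B = B * v.
Local Notation cC := (conj_aut J C).

Lemma Delta3 : Delta \in Autn 3 J.
Proof.
have [v Zv E] := Delta_B.
rewrite (AutnE genJ) // E Delta_A !mulKg Zv andbT.
by rewrite Z3E Bq_chain4.
Qed.

Lemma cC_Inn : cC \in Inn J.
Proof. by apply: mem_morphim => //; apply: (subsetP (normG J)). Qed.

Lemma conj_Autn n g : g \in J -> (conj_aut J g \in Autn n J) = (g \in 'Z_n.+1(J)).
Proof.
move=> Jg; rewrite (AutnE genJ) ?Aut_aut // !conj_autE // -!commgEl.
by rewrite (ucnS_gen genJ) Jg -[[~ A, g]]invg_comm -[[~ B, g]]invg_comm !groupV.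
Qed.

Lemma cC3 : cC \in Autn 3 J.
Proof. by rewrite (conj_Autn 3 JC) Z4E; apply: C_chain5. Qed.

Lemma chi_gen : chi_morphism @* <<[set Delta; cC]>> = 'Z_3(J) / 'Z_2(J).
Proof.
have sD : [set Delta; cC] \subset Autn 3 J.
  by apply/subsetP => x /set2P[]->; rewrite ?Delta3 ?cC3.
have cD : chi Delta = b by rewrite /chi Delta_A mulKg.
have ccC : chi cC = a ^+ ell.
  by rewrite /chi conj_autE // -commgEl (comm_A_C relAB) cX.
apply/eqP; rewrite eqEsubset; apply/andP; split.
  rewrite morphim_gen // gen_subG; apply/subsetP => x /morphimP[s _ /set2P[]-> ->] /=.
    by rewrite cD mem_quotient.
  by rewrite ccC groupX // mem_quotient.
have mb : b \in chi_morphism @* <<[set Delta; cC]>>.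
  by rewrite -cD -[chi _]/(chi_morphism _) mem_morphim ?Delta3 // mem_gen // !inE eqxx.
have ma : a \in chi_morphism @* <<[set Delta; cC]>>.
  have : a ^+ ell \in chi_morphism @* <<[set Delta; cC]>>.
    by rewrite -ccC -[chi _]/(chi_morphism _) mem_morphim ?cC3 // mem_gen // !inE eqxx orbT.
  have l0 : (0 < ell)%N by case: (ell) ellp; rewrite ?dvdn0.
  case: (egcdnP q l0) => v w E _ ha.
  have -> : a = a ^+ ell ^+ v; last exact: groupX.
  have co : coprime ell q by rewrite coprimeXr // coprime_sym prime_coprime.
  by rewrite -expgM mulnC E (eqnP co) expgD mulnC expgM aq expg1n mul1g expg1.
by apply/subsetP => c /mem_ucn_quo[x [y ->]]; apply: groupM; apply: groupX.
Qed.

Lemma chi_im : chi_morphism @* Autn 3 J = 'Z_3(J) / 'Z_2(J).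
Proof.
apply/eqP; rewrite eqEsubset -{2}chi_gen morphimS ?andbT; last first.
  by rewrite gen_subG; apply/subsetP => x /set2P[]->; rewrite ?Delta3 ?cC3.
apply/subsetP => c /morphimP[s _ s3 ->]; have [u Zu uE] := Autn_mulA s3.
by rewrite /= /chi uE mulKg mem_quotient.
Qed.

(** The subgroup generated by Delta and C delta already has full image under [chi], whose kernel is
    Aut_2. *)
Lemma Autn3E : Autn 3 J = <<[set Delta; cC]>> * Autn 2 J.
Proof.
have sD : <<[set Delta; cC]>> \subset Autn 3 J.
  by rewrite gen_subG; apply/subsetP => x /set2P[]->; rewrite ?Delta3 ?cC3.
have n2 : Autn 3 J \subset 'N(Autn 2 J).
  exact: subset_trans (Autn_sub J 3) (normal_norm (Autn_normal J 2)).
rewrite (normC (subset_trans sD n2)) -ker_chi -(morphimK chi_morphism sD) chi_gen -chi_im.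
by rewrite morphimK // mulSGid // subsetIl.
Qed.

Lemma Autn2_sub3 : Autn 2 J \subset Autn 3 J.
Proof. by rewrite -ker_chi; apply: subsetIl. Qed.

Lemma card_Autn3 : #|Autn 3 J| = (q ^ 6)%N.
Proof.
have s23 : 'ker chi_morphism \subset Autn 3 J by apply: subsetIl.
have e : #|Autn 3 J / 'ker chi_morphism| = #|'Z_3(J) / 'Z_2(J)|.
  by rewrite -chi_im; apply: card_isog (first_isog chi_morphism).
rewrite -(Lagrange s23) -card_quotient ?ker_norm // e card_ucn_quo.
transitivity (q ^ 4 * q ^ 2)%N; last by rewrite -expnD.
by congr (_ * _)%N; rewrite -card_Autn2 -ker_chi.
Qed.

Lemma Autn_quo_isog : Autn 3 J / Autn 2 J \isog [set: 'Z_q * 'Z_q].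
Proof.
have h : chi_morphism @* Autn 3 J \isog [set: 'Z_q * 'Z_q].
  by rewrite chi_im; apply: ucn_quo_isog.
by rewrite -ker_chi; apply: isog_trans (first_isog chi_morphism) h.
Qed.

Let K n : {group {perm gT}} := Group (Inn_mul_Autn_group_set J n).
Let nK n : K n <| Aut J. Proof. exact: Inn_mul_Autn_normal. Qed.

(** Among the generators of Aut_3 modulo Aut_2, C delta is inner and is absorbed by Inn(J). *)
Lemma Inn_Autn3E : Inn J * Autn 3 J = <[Delta]> * Inn J * Autn 2 J.
Proof.
have Inn_n := normal_norm (Inn_normal J).
have nD : <[Delta]> \subset 'N(Inn J) by rewrite cycle_subG (subsetP Inn_n).
apply/eqP; rewrite eqEsubset; apply/andP; split; last first.
  rewrite (normC nD) -mulgA; apply: mulgS; apply: (@mul_subG _ (Autn_group J 3)).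
    by rewrite cycle_subG; apply: Delta3.
  exact: Autn2_sub3.
rewrite Autn3E mulgA; apply: mulSg; rewrite (normC nD) -(norm_joinEr nD).
apply: mul_subG; first exact: joing_subl.
rewrite gen_subG; apply/subsetP => x /set2P[]->.
  by rewrite mem_gen // inE cycle_id orbT.
by rewrite mem_gen // inE cC_Inn.
Qed.

Lemma card_conj_aut (H : {group gT}) : 'Z_1(J) \subset H -> H \subset J ->
  (#|conj_aut J @* H| * q = #|H|)%N.
Proof.
move=> sZH sHJ; rewrite card_morphim (setIidPr (subset_trans sHJ (normG J))).
rewrite ker_conj_aut -card_Z1 mulnC.
rewrite -indexgI (_ : H :&: 'C(J) = 'Z_1(J)) ?Lagrange //.
apply/eqP; rewrite eqEsubset ucn1 subsetI -ucn1 sZH ucn1 subsetIr.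
by rewrite setSI.
Qed.

Lemma card_Inn : #|Inn J| = (q ^ 6)%N.
Proof.
apply/eqP; rewrite -(eqn_pmul2r q0) card_conj_aut ?ucn_sub //.
by rewrite card_J -expnSr.
Qed.

Lemma Inn_cap_Autn n : Inn J :&: Autn n J = conj_aut J @* 'Z_n.+1(J).
Proof.
have nJ := subsetP (normG J); have sZn : 'Z_n.+1(J) \subset J := ucn_sub _ _.
apply/setP => s; apply/setIP/morphimP => [[/morphimP[g ng Jg ->]] | [g ng Zg ->]].
  by rewrite conj_Autn // => Zg; exists g.
have Jg := subsetP sZn g Zg.
by rewrite conj_Autn // Zg; split=> //; apply: mem_morphim.
Qed.

(** Product formula: |Inn(J)| = q^6, and Inn(J) meets Aut_n in the image of Z_(n+1), of order
    |Z_(n+1)| / q. *)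
Lemma card_Inn_Autn n : (#|'Z_n.+1(J)| * #|(Inn J * Autn n J)%g| = q ^ 7 * #|Autn n J|)%N.
Proof.
have e := mul_cardG (Inn_group J) (Autn_group J n).
have sZn : 'Z_n.+1(J) \subset J := ucn_sub _ _.
have s1 : 'Z_1(J) \subset 'Z_n.+1(J) by apply: ucn_sub_geq.
have c := card_conj_aut s1 sZn.
rewrite -c -mulnA [(q * _)%N]mulnC mulnA -Inn_cap_Autn [(#|_ :&: _| * _)%N]mulnC.
rewrite -e mulnC [#|_|]card_Inn mulnA -expnS //.
Qed.

Lemma card_Inn_Autn3 : #|Inn J * Autn 3 J| = (q ^ 8)%N.
Proof.
have := card_Inn_Autn 3; rewrite card_Z4 card_Autn3 => e.
have qk : (0 < q ^ 5)%N by rewrite expn_gt0 q0.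
by apply/eqP; rewrite -(eqn_pmul2l qk) e -!expnD.
Qed.

Lemma card_Inn_Autn2 : #|Inn J * Autn 2 J| = (q ^ 7)%N.
Proof.
have := card_Inn_Autn 2; rewrite card_Z3 card_Autn2 => e.
have qk : (0 < q ^ 4)%N by rewrite expn_gt0 q0.
by apply/eqP; rewrite -(eqn_pmul2l qk) e -!expnD.
Qed.

Lemma Inn_Autn_quo_isog : (Inn J * Autn 3 J) / (Inn J * Autn 2 J) \isog [set: 'Z_q].
Proof.
apply: (@isog_quotient_Zp _ (K 2) (K 3) Delta q q1).
- by apply: (etrans Inn_Autn3E); rewrite -mulgA.
- exact: subset_trans (normal_sub (nK 3)) (normal_norm (nK 2)).
apply: (etrans card_Inn_Autn3); rewrite expnSr; congr (_ * _)%N.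
exact/esym/card_Inn_Autn2.
Qed.
End Main.

(** * Integer exponents and the final statement *)

Lemma expgz_nat (gT : finGroupType) (x : gT) N (n : int) (j k : nat) :
  x ^+ N = 1 -> (n + (N * j)%N%:Z = k%:Z)%R -> expgz x n = x ^+ k.
Proof.
move=> xN; case: n => a /= e.
  have -> : k = (a + N * j)%N by lia.
  by rewrite expgD expgM xN expg1n mulg1.
apply: (mulIg (x ^+ a.+1)); rewrite mulVg -expgD.
have -> : (k + a.+1 = N * j)%N by lia.
by rewrite expgM xN expg1n.
Qed.

Unset Implicit Arguments.
Set Strict Implicit.
Set Printing Implicit Defensive.

Theorem theorem4p4 (p m alpha ell : nat)
    (p_pr : prime p) (p_odd : odd p) (m_ge1 : (1 <= m)%N)
    (alpha_gt1 : (1 < alpha)%N) (v_alpha : logn p (alpha - 1) = m)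
    (alpha3 : p = 3 -> m = 1%N -> ((alpha - 1) %/ 3 = 1 %[mod 3])%N)
    (def_ell : alpha = (1 + ell * p ^ m)%N)
    (gT : finGroupType) (J : {group gT}) (A B : gT)
    (presJ : presents_J p m alpha J A B) :
  let C := [~ A, B] in
  let d := (if p == 3 then 3 ^ (m - 1) * ell else 0)%N in
  exists2 Delta : {perm gT}, Delta \in Aut J &
    [/\ Delta A = A * B ^+ (p ^ m),
        Delta B =
          B * expgz B (- (2%:Z - d%:Z) * (p ^ m)%:Z)%R * A ^+ (p ^ m) &
    [/\ Inn J * Autn 3 J = <[Delta]> * Inn J * Autn 2 J,
        Autn 3 J = <<[set Delta; conj_aut J C]>> * Autn 2 J,
        Autn 3 J / Autn 2 J \isog [set: 'Z_(p ^ m) * 'Z_(p ^ m)],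
        (Inn J * Autn 3 J) / (Inn J * Autn 2 J) \isog [set: 'Z_(p ^ m)] &
        #|Autn 3 J| = (p ^ (6 * m))%N /\
        #|Inn J * Autn 3 J| = (p ^ (8 * m))%N]].
Proof.
move=> C d; subst alpha; rewrite addKn in v_alpha alpha3.
have q0 : (0 < p ^ m)%N by rewrite expn_gt0 prime_gt0.
have l0 : (0 < ell)%N by move: alpha_gt1; rewrite add1n ltnS muln_gt0 => /andP[].
have ellp : ~~ (p %| ell)%N.
  move: v_alpha; rewrite lognM // pfactorK // -[RHS]add0n => /addIn; apply: contra_eqN => pl.
  by rewrite -lt0n logn_gt0 mem_primes p_pr l0.
have ell3 : p = 3 -> m = 1%N -> (ell = 1 %[mod 3])%N.
  by move=> p3 m1; have := alpha3 p3 m1; rewrite p3 m1 expn1 mulnK.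
have [genJ relAB _] := presJ.
have cJ := card_J_ge p_pr p_odd m_ge1 ellp presJ.
set q := (p ^ m)%N in q0 *.
(* A natural number congruent to d - 2 modulo q^2. Adding 2 q^3 to -(2 - d) q gives exactly q y2,
   whence the factor 2 in [vE]. *)
pose y2 := (d + 2 * (q ^ 2).-1)%N.
have q2E : (2 * (q ^ 2).-1 + 2 = 2 * q ^ 2)%N.
  by rewrite -mulnSr prednK // expn_gt0 q0.
have vE : expgz B (- (2%:Z - d%:Z) * q%:Z)%R = B ^+ q ^+ y2.
  rewrite (@expgz_nat _ B (q ^ 3) _ 2 (q * y2) (Bq3 relAB)) ?expgM //.
  have -> : (q ^ 3 * 2 = q * (2 * (q ^ 2).-1 + 2))%N by rewrite q2E; ring.
  rewrite /y2; move: (_.-1) => r; first [ring | lia].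
have Z1 : 1 \in 'Z_2(J) by rewrite group1.
have cAB := commute_Aq_Bq p_pr p_odd m_ge1 ellp ell3 relAB.
have c3E : ('C(1 + ell * p ^ m, 3) = d %[mod q])%N := bin3_alpha_mod ell p_pr p_odd m_ge1.
have y2E : (y2 + 2 = 2 * q * q + d)%N.
  by rewrite /y2 -addnA q2E addnC; congr (_ + _)%N; ring.
pose v := A ^+ q * B ^+ q ^+ y2.
have vZ : v \in 'Z_3(J).
  by have := eltZ3 p_pr p_odd m_ge1 ellp ell3 presJ 1%N y2 Z1; rewrite mul1g expg1.
have uZ : B ^+ q \in 'Z_3(J).
  by have := eltZ3 p_pr p_odd m_ge1 ellp ell3 presJ 0%N 1%N Z1; rewrite mulg1 mul1g expg1.
(* At (x1, y1, x2, y2) = (0, 1, 1, d - 2) both congruences read d = binom(alpha, 3). *)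
have rD : J_relations p m (1 + ell * q) (A * B ^+ q) (B * v).
  have := J_relations_perturb p_pr p_odd m_ge1 ellp ell3 genJ relAB cJ 0%N 1%N 1%N y2 Z1 Z1.
  rewrite !mul1g !expg1 => -[_]; apply.
  by rewrite add0n muln1 mul1n addn0 [(2 + y2)%N]addnC y2E modnMDl c3E.
have [Delta DA [DeA DeB]] := exists_aut p_pr p_odd m_ge1 ellp ell3 presJ uZ vZ rD.
have DB : exists2 w, w \in 'Z_3(J) & Delta B = B * w by exists v.
exists Delta; first exact: DA.
split; first exact: DeA.
  by rewrite DeB vE /v -mulgA; congr (_ * _); apply: commuteX.
split.
- exact: (Inn_Autn3E p_pr p_odd m_ge1 ellp ell3 presJ DA DeA DB).
- exact: (Autn3E p_pr p_odd m_ge1 ellp ell3 presJ DA DeA DB).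
- exact: (Autn_quo_isog p_pr p_odd m_ge1 ellp ell3 presJ DA DeA DB).
- exact: (Inn_Autn_quo_isog p_pr p_odd m_ge1 ellp ell3 presJ DA DeA DB).
rewrite ![(_ * m)%N]mulnC !expnM; split.
  exact: (card_Autn3 p_pr p_odd m_ge1 ellp ell3 presJ DA DeA DB).
exact: (card_Inn_Autn3 p_pr p_odd m_ge1 ellp ell3 presJ DA DeA DB).
Qed.
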